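(* For $n\in\mathbb{N}$, let $f_n$ be centred inner functions such that $F_n=f_n\circ\cdots\circ f_1$ is contracting. Then the following equivalent properties hold: (a) for every $\zeta_0\in\partial\mathbb{D}$, we have $\liminf_{n\to\infty}|F_n(\zeta)-\zeta_0|=0$ for almost every $\zeta\in\partial\mathbb{D}$; (b) for every arc $I\subset\partial\mathbb{D}$ of positive length, $F_n(\zeta)\in I$ infinitely often, for almost every $\zeta\in\partial\mathbb{D}$; (c) $(F_n(\zeta))$ is dense in $\partial\mathbb{D}$ for almost every $\zeta\in\partial\mathbb{D}$.
   Context: $\mathbb{D}=\{z\in\mathbb{C}:|z|<1\}$. An inner function is a holomorphic map $f:\mathbb{D}\to\mathbb{D}$ whose radial boundary extension (also denoted $f$, defined at almost every point of $\partial\mathbb{D}$) takes values in $\partial\mathbb{D}$ almost everywhere. An inner function $f$ is centred if $f(0)=0$. Compositions on the boundary are compositions of radial boundary extensions, defined almost everywhere. ''Almost every'' refers to arc length (Lebesgue) measure on $\partial\mathbb{D}$. The sequence $(F_n)$ is contracting if the hyperbolic distance in $\mathbb{D}$ between $F_n(z)$ and $F_n(z')$ tends to $0$ as $n\to\infty$ for any (equivalently, every) pair of distinct points $z,z'\in\mathbb{D}$. For forward compositions of centred inner functions this is equivalent to $\sum_{n=1}^\infty(1-|f_n'(0)|)=\infty$. *)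

(* Defs.v *)
From HB Require Import structures.
From mathcomp Require Export all_boot all_order all_algebra complex.
From mathcomp Require Export all_classical all_reals all_analysis.

Set Implicit Arguments.
Unset Strict Implicit.
Unset Printing Implicit Defensive.

Export Order.TTheory GRing.Theory Num.Theory.
Export numFieldNormedType.Exports.

Local Open Scope classical_set_scope.
Local Open Scope ring_scope.
Local Open Scope complex_scope.

(* [f 0], [f 1], ... stand for the maps f_1, f_2, ..., so that
   [comp_seq f n] is f_(n+1) o ... o f_1. *)
Fixpoint comp_seq (T : Type) (f : nat -> T -> T) (n : nat) : T -> T :=
  if n is m.+1 then f m.+1 \o comp_seq f m else f 0%N.

Section disc_and_circle.
Variable R : realType.

(* The topology and the normed module structure over [R[i]] live on the regular
   algebra [R[i]^o]; its norm takes values in [R[i]], whence [absC]. *)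
Local Notation C := (R[i]^o).

Definition absC (z : C) : R := complex.Re `|z|.

Definition unit_disc : set C := [set z | absC z < 1].

Definition unit_circle : set C := [set z | absC z = 1].

Definition cis (t : R) : C := cos t +i* sin t.

Definition arc_length (A : set C) : \bar R :=
  lebesgue_measure (`[0, 2 * pi[ `&` cis @^-1` A).

Definition ae_circle (P : C -> Prop) : Prop :=
  {ae @lebesgue_measure R, forall t : R, t \in `[0, 2 * pi[ -> P (cis t)}.

(* Arcs may contain any of their endpoints; the full circle, points and the
   empty set are (degenerate) arcs. *)
Definition arc (I : set C) : Prop :=
  exists J : interval R, I = cis @` [set` J].

Definition radial_limit_exists (f : C -> C) (zeta : C) : Prop :=
  cvg (f (r%:C * zeta) @[r --> (1 : R)^'-]).

(* A default value where the radial limit does not exist. *)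
Definition radial_ext (f : C -> C) (zeta : C) : C :=
  lim (f (r%:C * zeta) @[r --> (1 : R)^'-]).

(* Differentiability over the field [R[i]], i.e. complex differentiability;
   the values of [f] outside the disc are irrelevant. *)
Definition holomorphic_on_disc (f : C -> C) : Prop :=
  forall z, unit_disc z -> derivable f z 1.

Definition inner (f : C -> C) : Prop :=
  [/\ holomorphic_on_disc f,
      forall z, unit_disc z -> unit_disc (f z) &
      ae_circle (fun zeta =>
        radial_limit_exists f zeta /\ unit_circle (radial_ext f zeta))].

Definition centred_inner (f : C -> C) : Prop := inner f /\ f 0 = 0.

(* Hyperbolic distance of the disc, for the metric 2|dz|/(1 - |z|^2). *)
Definition hyp_dist (z w : C) : R :=
  let p := absC ((z - w) / (1 - conjc w * z)) in ln ((1 + p) / (1 - p)).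

Definition contracting (F : nat -> C -> C) : Prop :=
  forall z z' : C, unit_disc z -> unit_disc z' -> z != z' ->
    hyp_dist (F n z) (F n z') @[n --> \oo] --> (0 : R).

(* The composition of the boundary extensions; it avoids the default values
   for almost every point of the circle. *)
Definition boundary_comp (f : nat -> C -> C) : nat -> C -> C :=
  comp_seq (fun n => radial_ext (f n)).

Definition liminf_dist_zero (w : nat -> C) (zeta0 : C) : Prop :=
  limn_einf (fun n => (absC (w n - zeta0))%:E) = 0%E.

Definition infinitely_often (I : set C) (w : nat -> C) : Prop :=
  forall N : nat, exists2 n : nat, (N <= n)%N & I (w n).

Definition dense_in_circle (w : nat -> C) : Prop :=
  unit_circle `<=` closure (range w).

End disc_and_circle.

(* Main.v *)
Require Import Defs.
From mathcomp Require Import measurable_realfun ring lra.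

(** Write [F_n] for the composition and [phi_n] for its boundary map. Since
    [F_n z --> 0] for all [z] in the disc, the image of the harmonic measure
    [omega_z] under [phi_n] converges weakly to arc length. Let [A] be the
    set of points whose orbit avoids a given arc [I] from time [N] on. Then
    [omega_z(A)] is at most the [omega_z]-measure of [phi_n^-1 (~` I)] for
    all [n >= N], hence at most [1 - |I| / (2 pi) < 1], uniformly in [z]; as
    the Poisson integral of the indicator of [A] tends to that indicator,
    [A] is a null set.

    For [h] holomorphic near the closed disc,
    [\int h(phi_n) P_z = \int_(|w| = rho) h(F_n w) Q_z(w)] for
    [|z| < rho < 1], where [Q_z], holomorphic on [|z| < |w| < 1 / |z|], equals
    the Poisson kernel [P_z] on the unit circle. For [phi = cis] this is the
    invariance of circular means on an annulus (Goursat's lemma for [e^(s+it)]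
    on rectangles). It passes from [phi] to [f o phi] by dominated convergence
    along the radii, because [z = 0] makes [phi] preserve arc length and so
    pull null sets back to null sets. Taking for [h] the kernel
    [(1 + conj w zeta) / (1 - conj w zeta)], whose real part on the circle is
    [P_w], yields the weak limit. Working with the composed boundary maps
    directly avoids identifying them with the radial limits of [F_n]. *)

Set Implicit Arguments.
Unset Strict Implicit.
Unset Printing Implicit Defensive.

Local Open Scope classical_set_scope.
Local Open Scope ring_scope.
Local Open Scope complex_scope.

(** * Goursat's lemma for closed differential forms on rectangles *)

Section goursat.
Variable R : realType.
Implicit Types (P Q : R -> R -> R) (f g : R -> R).
Local Notation mu := (@lebesgue_measure R).

(** The transport identity is needed for all [h], not only for the kernels used at the end: the
    inductive step applies it to [h (f (r w))], which is differentiable on the whole closed disc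
    when r < 1, and then lets r tend to 1. The holomorphic factor [Q_z] is there because a product
    of two harmonic functions is in general not harmonic, whereas the real part of a product of
    holomorphic functions has constant circular means on an annulus; as [Q_z] is real on the unit
    circle, [Re h * P_z] is such a real part there. Limits of measures are recognised by their
    Poisson integrals: a measure whose Poisson integral is constant is a multiple of arc length, so
    it matters that the limit found does not depend on the base point of the kernel. Test functions
    are Lipschitz on the plane and can thus be composed with any boundary map; sets are reached as
    positivity sets of such functions. The Poisson integral of an indicator is likewise compared
    with that indicator only weakly, against test functions. *)

Lemma integrable_EFinB f g (a b : R) :
  mu.-integrable `[a, b] (EFin \o f) -> mu.-integrable `[a, b] (EFin \o g) ->
  mu.-integrable `[a, b] (EFin \o (fun x => f x - g x)).
Proof. by move=> If Ig; apply: (integrableB _ If Ig). Qed.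

Lemma continuous_itv_integrable f (a b : R) :
  (forall x, a <= x <= b -> {for x, continuous f}) ->
  mu.-integrable `[a, b] (EFin \o f).
Proof.
move=> cf; apply: continuous_compact_integrable; first exact: segment_compact.
by apply: continuous_in_subspaceT => x; rewrite inE /= in_itv /=; exact: cf.
Qed.

Lemma Rintegral_itv_split f (a c b : R) : a <= c -> c <= b ->
  (forall x, a <= x <= b -> {for x, continuous f}) ->
  \int[mu]_(x in `[a, b]) f x =
  \int[mu]_(x in `[a, c]) f x + \int[mu]_(x in `[c, b]) f x.
Proof.
move=> ac cb cf.
have If := continuous_itv_integrable cf.
have := @Rintegral_itvB R f (BLeft a) (BRight b) c If.
rewrite !bnd_simp => /(_ ac cb).
rewrite Rintegral_itv_obnd_cbnd; first by move=> <-; rewrite addrC subrK.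
by apply: integrableS If => // x /=; rewrite !in_itv /= => /andP[/ltW cx ->];
   rewrite andbT (le_trans ac).
Qed.

Lemma Rintegral_itv_near_cst f (a b c e : R) : a <= b ->
  mu.-integrable `[a, b] (EFin \o f) ->
  (forall x, a <= x <= b -> `|f x - c| <= e) ->
  `|\int[mu]_(x in `[a, b]) f x - c * (b - a)| <= e * (b - a).
Proof.
move=> ab If fce.
have Ic r : mu.-integrable `[a, b] (EFin \o cst r).
  by apply: continuous_itv_integrable => x _; exact: cvg_cst.
have Icst r : \int[mu]_(x in `[a, b]) r = r * (b - a).
  rewrite Rintegral_cst //= lebesgue_measure_itv /= lte_fin.
  by move: ab; rewrite le_eqVlt => /predU1P[->|->//]; rewrite ltxx subrr.
rewrite ler_distl; apply/andP; split.
- rewrite -mulrBl -Icst; apply: le_Rintegral => //; first exact: Ic.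
  by move=> x /=; rewrite in_itv /= => /fce; rewrite ler_distl => /andP[].
- rewrite -mulrDl -Icst; apply: le_Rintegral => //; first exact: Ic.
  by move=> x /=; rewrite in_itv /= => /fce; rewrite ler_distl => /andP[].
Qed.

(** The form is P ds + Q dt. The shared coefficient [b] expresses closedness: the t-derivative of
    [P] equals the s-derivative of [Q]. Differentiability is pointwise, as in Goursat's argument; no
    continuity of derivatives is assumed. *)
Definition closed_form_at P Q (s0 t0 : R) := exists a b c : R,
  forall e : R, 0 < e -> exists2 d : R, 0 < d & forall s t : R,
    `|s - s0| <= d -> `|t - t0| <= d ->
    `|P s t - P s0 t0 - (a * (s - s0) + b * (t - t0))|
       <= e * (`|s - s0| + `|t - t0|) /\
    `|Q s t - Q s0 t0 - (b * (s - s0) + c * (t - t0))|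
       <= e * (`|s - s0| + `|t - t0|).

Lemma linear_approx_continuous f (x a : R) :
  (exists2 d : R, 0 < d & forall y : R, `|y - x| <= d ->
     `|f y - f x - a * (y - x)| <= `|y - x|) ->
  {for x, continuous f}.
Proof.
move=> [d d0 fd]; apply/cvgrPdist_le => e e0; near=> y.
have yd : `|y - x| <= d.
  near: y; apply/nbhs_ballP; exists d => //= y /=.
  by rewrite /ball /= distrC => /ltW.
have ye : `|y - x| <= e / (1 + `|a|).
  near: y; apply/nbhs_ballP; exists (e / (1 + `|a|)) => /=.
    by rewrite divr_gt0 // ltr_pwDl.
  by move=> y /=; rewrite /ball /= distrC => /ltW.
rewrite distrC -(subrK (a * (y - x)) (f y - f x)).
apply: (le_trans (ler_normD _ _)); rewrite normrM.
have := fd _ yd; move: ye; rewrite ler_pdivlMr ?ltr_pwDl // => ye h.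
by rewrite (le_trans (lerD h (lexx _))) // -[leLHS]addr0; lra.
Unshelve. all: by end_near. Qed.

Lemma closed_form_continuous P Q (s t : R) : closed_form_at P Q s t ->
  {for s, continuous (P^~ t)} /\ {for t, continuous (Q s)}.
Proof.
move=> [a [b [c H]]]; have [d d0 h] := H 1 ltr01.
have dd (x : R) : `|x - x| <= d by rewrite subrr normr0 ltW.
split; [apply: (@linear_approx_continuous _ _ a)|
        apply: (@linear_approx_continuous _ _ c)];
  exists d => // y yd.
- by have [] := h y t yd (dd t); rewrite subrr normr0 mulr0 !addr0 mul1r.
- by have [_] := h s y (dd s) yd; rewrite subrr normr0 mulr0 !add0r mul1r.
Qed.

(** The integral of P ds + Q dt along the counterclockwise boundary of the rectangle with lower left
    corner (s, t) and sides [h], [k]. *)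
Definition circulation P Q (s h t k : R) :=
  \int[mu]_(x in `[s, s + h]) P x t - \int[mu]_(x in `[s, s + h]) P x (t + k) +
  \int[mu]_(y in `[t, t + k]) Q (s + h) y - \int[mu]_(y in `[t, t + k]) Q s y.

Definition closed_form_on P Q (s h t k : R) :=
  forall x y, s <= x <= s + h -> t <= y <= t + k -> closed_form_at P Q x y.

Lemma circulation_quarter P Q (s h t k : R) : 0 <= h -> 0 <= k ->
  closed_form_on P Q s (h + h) t (k + k) ->
  circulation P Q s (h + h) t (k + k) =
  circulation P Q s h t k + circulation P Q (s + h) h t k +
  circulation P Q s h (t + k) k + circulation P Q (s + h) h (t + k) k.
Proof.
move=> h0 k0 H.
have cP y : t <= y <= t + (k + k) -> forall x, s <= x <= s + (h + h) ->
    {for x, continuous (P^~ y)}.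
  by move=> ty x sx; have [] := closed_form_continuous (H _ _ sx ty).
have cQ x : s <= x <= s + (h + h) -> forall y, t <= y <= t + (k + k) ->
    {for y, continuous (Q x)}.
  by move=> sx y ty; have [] := closed_form_continuous (H _ _ sx ty).
rewrite /circulation.
rewrite (@Rintegral_itv_split (P^~ t) _ (s + h)); [|lra|lra|apply: cP; lra].
rewrite (@Rintegral_itv_split (P^~ (t + (k + k))) _ (s + h));
  [|lra|lra|apply: cP; lra].
rewrite (@Rintegral_itv_split (Q s) _ (t + k)); [|lra|lra|apply: cQ; lra].
rewrite (@Rintegral_itv_split (Q (s + (h + h))) _ (t + k));
  [|lra|lra|apply: cQ; lra].
by rewrite !addrA; ring.
Qed.

(** Between opposite sides the affine parts of [P] and [Q] change by the constants -b k and b h,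
    whose integrals -b k h and b h k cancel. What remains is at most 2 e (h + k) along lengths [h]
    and [k]. *)
Lemma circulation_bound P Q (s h t k s0 t0 a b c e : R) :
  0 <= h -> 0 <= k -> 0 <= e ->
  s <= s0 <= s + h -> t <= t0 <= t + k ->
  closed_form_on P Q s h t k ->
  (forall x y, s <= x <= s + h -> t <= y <= t + k ->
    `|P x y - P s0 t0 - (a * (x - s0) + b * (y - t0))|
       <= e * (`|x - s0| + `|y - t0|) /\
    `|Q x y - Q s0 t0 - (b * (x - s0) + c * (y - t0))|
       <= e * (`|x - s0| + `|y - t0|)) ->
  `|circulation P Q s h t k| <= 2 * e * (h + k) ^+ 2.
Proof.
move=> h0 k0 e0 ss0 tt0 H HPQ.
have IP y : t <= y <= t + k -> mu.-integrable `[s, s + h] (EFin \o P^~ y).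
  move=> ty; apply: continuous_itv_integrable => x sx.
  by have [] := closed_form_continuous (H _ _ sx ty).
have IQ x : s <= x <= s + h -> mu.-integrable `[t, t + k] (EFin \o Q x).
  move=> sx; apply: continuous_itv_integrable => y ty.
  by have [] := closed_form_continuous (H _ _ sx ty).
have ler_bnd x y : s <= x <= s + h -> t <= y <= t + k ->
    `|x - s0| + `|y - t0| <= h + k.
  by move=> ? ?; apply: lerD; rewrite ler_norml; lra.
have eb x y : s <= x <= s + h -> t <= y <= t + k ->
    e * (`|x - s0| + `|y - t0|) <= e * (h + k).
  by move=> sx ty; rewrite ler_wpM2l // ler_bnd.
have tk1 : t <= t <= t + k by lra.
have tk2 : t <= t + k <= t + k by lra.
have sh1 : s <= s <= s + h by lra.
have sh2 : s <= s + h <= s + h by lra.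
have A1 : `|\int[mu]_(x in `[s, s + h]) (P x t - P x (t + k))
    - (- (b * k)) * (s + h - s)| <= 2 * (e * (h + k)) * (s + h - s).
  apply: Rintegral_itv_near_cst; first by lra.
    exact: integrable_EFinB (IP _ tk1) (IP _ tk2).
  move=> x sx.
  have [h1 _] := HPQ _ _ sx tk1; have [h2 _] := HPQ _ _ sx tk2.
  have := le_trans h1 (eb _ _ sx tk1); have := le_trans h2 (eb _ _ sx tk2).
  rewrite !ler_norml => /andP[u1 u2] /andP[u3 u4].
  by apply/andP; split; lra.
have A2 : `|\int[mu]_(y in `[t, t + k]) (Q (s + h) y - Q s y)
    - (b * h) * (t + k - t)| <= 2 * (e * (h + k)) * (t + k - t).
  apply: Rintegral_itv_near_cst; first by lra.
    exact: integrable_EFinB (IQ _ sh2) (IQ _ sh1).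
  move=> y ty.
  have [_ h1] := HPQ _ _ sh1 ty; have [_ h2] := HPQ _ _ sh2 ty.
  have := le_trans h1 (eb _ _ sh1 ty); have := le_trans h2 (eb _ _ sh2 ty).
  rewrite !ler_norml => /andP[u1 u2] /andP[u3 u4].
  by apply/andP; split; lra.
move: A1 A2.
rewrite RintegralB //; [|exact: IP|exact: IP].
rewrite RintegralB //; [|exact: IQ|exact: IQ].
rewrite /circulation !ler_norml => /andP[u1 u2] /andP[u3 u4].
by apply/andP; split; nra.
Qed.

(** Bisection: some nested rectangle at scale 2^-n carries at least the fraction 4^-n of the
    circulation, while differentiability at the common point makes its circulation o(4^-n). *)
Lemma goursat_rectangle P Q (s h t k : R) : 0 <= h -> 0 <= k ->
  closed_form_on P Q s h t k -> circulation P Q s h t k = 0.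
Proof.
move=> h0 k0 H.
pose hh n : R := h / 2 ^+ n; pose kk n : R := k / 2 ^+ n.
have hhS n : hh n = hh n.+1 + hh n.+1.
  by rewrite /hh exprS; field; rewrite expf_neq0.
have kkS n : kk n = kk n.+1 + kk n.+1.
  by rewrite /kk exprS; field; rewrite expf_neq0.
have hh0 n : 0 <= hh n by rewrite divr_ge0 // exprn_ge0.
have kk0 n : 0 <= kk n by rewrite divr_ge0 // exprn_ge0.
pose good n (p : R * R) := [/\ closed_form_on P Q p.1 (hh n) p.2 (kk n) &
  `|circulation P Q s h t k| <=
    4 ^+ n * `|circulation P Q p.1 (hh n) p.2 (kk n)|].
pose nxt n (p q : R * R) := [/\ p.1 <= q.1, q.1 + hh n.+1 <= p.1 + hh n,
  p.2 <= q.2 & q.2 + kk n.+1 <= p.2 + kk n].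
have step n p : good n p -> exists q, good n.+1 q /\ nxt n p q.
  move=> [Hp cp].
  have sub q : nxt n p q ->
      closed_form_on P Q q.1 (hh n.+1) q.2 (kk n.+1).
    by move=> [? ? ? ?] x y qx qy; apply: Hp; lra.
  have := @circulation_quarter P Q p.1 (hh n.+1) p.2 (kk n.+1) (hh0 _) (kk0 _).
  rewrite -hhS -kkS => /(_ Hp) E.
  pose q1 := p; pose q2 := (p.1 + hh n.+1, p.2).
  pose q3 := (p.1, p.2 + kk n.+1); pose q4 := (p.1 + hh n.+1, p.2 + kk n.+1).
  have hn := hhS n; have kn := kkS n.
  have h0' := hh0 n.+1; have k0' := kk0 n.+1.
  (* If no quarter qualified, the four strict inequalities [small] would add up against the triangle
     inequality for [circulation_quarter]. *)
  apply: contrapT => /forallNP N.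
  have small q : nxt n p q -> 4 ^+ n.+1 *
      `|circulation P Q q.1 (hh n.+1) q.2 (kk n.+1)| <
      `|circulation P Q s h t k|.
    move=> nq; rewrite ltNge; apply/negP => le; apply: (N q); split => //.
    by split => //; exact: sub.
  have n1 : nxt n p q1 by split; rewrite /=; lra.
  have n2 : nxt n p q2 by split; rewrite /=; lra.
  have n3 : nxt n p q3 by split; rewrite /=; lra.
  have n4 : nxt n p q4 by split; rewrite /=; lra.
  move: (small _ n1) (small _ n2) (small _ n3) (small _ n4) cp.
  rewrite E /= !exprS.
  move: (circulation P Q s h t k) (circulation P Q p.1 _ p.2 _)
    (circulation P Q (p.1 + _) _ p.2 _) (circulation P Q p.1 _ (p.2 + _) _)
    (circulation P Q (p.1 + _) _ (p.2 + _) _) => C c1 c2 c3 c4.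
  have p4 : 0 < 4 ^+ n :> R by rewrite exprn_gt0.
  move: (4 ^+ n) p4 => z z0 l1 l2 l3 l4.
  have : `|c1 + c2 + c3 + c4| <= `|c1| + `|c2| + `|c3| + `|c4|.
    by rewrite (le_trans (ler_normD _ _)) // lerD2r
      (le_trans (ler_normD _ _)) // lerD2r ler_normD.
  move=> le le2; have := le_trans le2 (ler_wpM2l (ltW z0) le).
  by apply/negP; rewrite -ltNge; lra.
(* The choice function is made total: at a corner that is not good it returns that corner. *)
have [nx nxP] : {nx : nat -> R * R -> R * R & forall n p, good n p ->
    good n.+1 (nx n p) /\ nxt n p (nx n p)}.
  have e n p : exists q, good n p -> good n.+1 q /\ nxt n p q.
    have [gp|ngp] := pselect (good n p); last by exists p.
    by have [q] := step _ _ gp; exists q.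
  exists (fun n p => projT1 (cid (e n p))) => n p gp.
  by case: (cid (e n p)) => /= q; apply.
pose u := fix u n := if n is m.+1 then nx m (u m) else (s, t).
have gu n : good n (u n).
  elim: n => [|n IH]; last by have [] := nxP _ _ IH.
  by split; rewrite /= /hh /kk !expr0 !divr1 // mul1r.
have uS n : nxt n (u n) (u n.+1) by have [_] := nxP _ _ (gu n).
have mono n m : (u n).1 <= (u (n + m)%N).1 /\
    (u (n + m)%N).1 + hh (n + m)%N <= (u n).1 + hh n /\
    (u n).2 <= (u (n + m)%N).2 /\
    (u (n + m)%N).2 + kk (n + m)%N <= (u n).2 + kk n.
  elim: m => [|m [i1 [i2 [i3 i4]]]]; first by rewrite addn0 !lexx.
  by rewrite addnS; have [? ? ? ?] := uS (n + m)%N; repeat split; lra.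
have cross n m : (u n).1 <= (u m).1 + hh m /\ (u n).2 <= (u m).2 + kk m.
  have [/subnKC E|/ltnW/subnKC E] := leqP n m.
    have := mono n (m - n)%N; rewrite E.
    by have := hh0 m; have := kk0 m; lra.
  have := mono m (n - m)%N; rewrite E.
  by have := hh0 n; have := kk0 n; lra.
(* By [cross], every left end lies below every right end, so the supremum of the left ends belongs
   to all the intervals. *)
have [s0 s0P] : exists s0, forall n, (u n).1 <= s0 <= (u n).1 + hh n.
  pose S := range (fun n => (u n).1); exists (sup S) => n.
  have S0 : S !=set0 by exists (u 0%N).1; exists 0%N.
  have Sb m : ubound S ((u m).1 + hh m).
    by move=> _ [i _ <-]; have [] := cross i m.
  apply/andP; split; last exact: ge_sup.
  by apply: sup_upper_bound; [split => //; exists ((u 0%N).1 + hh 0%N)|exists n].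
have [t0 t0P] : exists t0, forall n, (u n).2 <= t0 <= (u n).2 + kk n.
  pose S := range (fun n => (u n).2); exists (sup S) => n.
  have S0 : S !=set0 by exists (u 0%N).2; exists 0%N.
  have Sb m : ubound S ((u m).2 + kk m).
    by move=> _ [i _ <-]; have [] := cross i m.
  apply/andP; split; last exact: ge_sup.
  by apply: sup_upper_bound; [split => //; exists ((u 0%N).2 + kk 0%N)|exists n].
have [a [b [c Hc]]] : closed_form_at P Q s0 t0.
  apply: H; have := s0P 0%N; have := t0P 0%N.
    by rewrite /= /hh expr0 divr1.
  by rewrite /= /kk expr0 divr1.
apply/eqP; rewrite -normr_le0; apply/ler_addgt0Pl => e e0; rewrite addr0.
(* Chosen so that the rescaled bound 2 e' (h + k)^2 is at most [e]; the added 1 keeps the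
   denominator positive for a degenerate rectangle. *)
pose e' := e / (2 * ((h + k) ^+ 2 + 1)).
have e'0 : 0 < e'.
  by rewrite divr_gt0 // mulr_gt0 // ltr_wpDl // exprn_ge0 // addr_ge0.
have [d d0 Hd] := Hc _ e'0.
have [n nd] : exists n, hh n <= d /\ kk n <= d.
  have [n] : exists n : nat, (h + k) / d < 2 ^+ n.
    exists (Num.bound ((h + k) / d)).
    apply: (lt_le_trans (archi_boundP _)); first by rewrite divr_ge0 ?addr_ge0 // ltW.
    by rewrite -natrX ler_nat ltnW // ltn_expl.
  rewrite ltr_pdivrMr // => hn; exists n.
  by rewrite /hh /kk !ler_pdivrMr ?exprn_gt0 // mulrC; lra.
have [gn1 gn2] := gu n.
have := @circulation_bound P Q (u n).1 (hh n) (u n).2 (kk n) s0 t0 a b c e'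
  (hh0 n) (kk0 n) (ltW e'0) (s0P n) (t0P n) gn1.
have HH x y : (u n).1 <= x <= (u n).1 + hh n ->
   (u n).2 <= y <= (u n).2 + kk n -> `|x - s0| <= d /\ `|y - t0| <= d.
  by move=> ? ?; have := s0P n; have := t0P n => ? ?;
     rewrite !ler_norml; split; apply/andP; split; lra.
move=> B.
apply: (le_trans gn2).
apply: (@le_trans _ _ (4 ^+ n * (2 * e' * (hh n + kk n) ^+ 2))).
  rewrite ler_wpM2l ?exprn_ge0 //; apply: B => x y ux uy.
  by have [? ?] := HH _ _ ux uy; exact: Hd.
have -> : 4 ^+ n * (2 * e' * (hh n + kk n) ^+ 2) = 2 * e' * (h + k) ^+ 2.
  have -> : 4 = 2 ^+ 2 :> R by rewrite -natrX.
  rewrite /hh /kk -exprM mulnC exprM; field.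
  by rewrite expf_neq0.
rewrite /e'; set z := (h + k) ^+ 2.
have z0 : 0 <= z by rewrite exprn_ge0 // addr_ge0.
have -> : 2 * (e / (2 * (z + 1))) * z = e * (z / (z + 1)) by field; lra.
by rewrite ler_piMr ?(ltW e0) // ler_pdivrMr ?mul1r ?lerDl // ltr_wpDl.
Qed.

End goursat.

(** * The modulus and the topology of the complex plane *)

Section complex_modulus.
Variable R : realType.
Local Notation C := (R[i]^o).
Implicit Types (z w : C) (x y t : R).

Lemma normC_absC z : `|z| = (absC z)%:C.
Proof. by rewrite /absC normc_def. Qed.

Lemma absCE z : absC z = Num.sqrt ((complex.Re z) ^+ 2 + (complex.Im z) ^+ 2).
Proof. by rewrite /absC normc_def. Qed.

Lemma sqr_absC z : absC z ^+ 2 = (complex.Re z) ^+ 2 + (complex.Im z) ^+ 2.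
Proof. by rewrite absCE sqr_sqrtr // addr_ge0 ?sqr_ge0. Qed.

Lemma absC_ge0 z : 0 <= absC z.
Proof. by rewrite absCE sqrtr_ge0. Qed.

Lemma absC0 : absC (0 : C) = 0.
Proof. by rewrite /absC normr0. Qed.

Lemma absC1 : absC (1 : C) = 1.
Proof. by rewrite /absC normr1. Qed.

Lemma absC_eq0 z : (absC z == 0) = (z == 0).
Proof.
by rewrite -[RHS]normr_eq0 normC_absC eq_complex /= eqxx andbT.
Qed.

Lemma absC_gt0 z : (0 < absC z) = (z != 0).
Proof. by rewrite lt_neqAle absC_ge0 andbT eq_sym absC_eq0. Qed.

Lemma absCM z w : absC (z * w) = absC z * absC w.
Proof. by apply: complexI; rewrite rmorphM /= -!normC_absC normrM. Qed.

Lemma absCD z w : absC (z + w) <= absC z + absC w.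
Proof. by rewrite -lecR rmorphD /= -!normC_absC ler_normD. Qed.

Lemma absCN z : absC (- z) = absC z.
Proof. by rewrite /absC normrN. Qed.

Lemma absC_distC z w : absC (z - w) = absC (w - z).
Proof. by rewrite -absCN opprB. Qed.

Lemma absCV z : absC z^-1 = (absC z)^-1.
Proof.
by apply: complexI; rewrite fmorphV /= -!normC_absC normfV.
Qed.

Lemma absC_conj z : absC (conjc z : C) = absC z.
Proof. by rewrite /absC normcJ. Qed.

Lemma absC_real x : absC (x%:C : C) = `|x|.
Proof. by rewrite absCE /= expr0n addr0 sqrtr_sqr. Qed.

Lemma Re_le_absC z : `|complex.Re z| <= absC z.
Proof. by rewrite -lecR -normC_absC normc_ge_Re. Qed.

Lemma Im_le_absC z : `|complex.Im z| <= absC z.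
Proof.
by rewrite absCE -sqrtr_sqr ler_wsqrtr // lerDr sqr_ge0.
Qed.

Lemma absC_le_ReIm z : absC z <= `|complex.Re z| + `|complex.Im z|.
Proof.
rewrite -(@ler_pXn2r _ 2) ?nnegrE ?absC_ge0 ?addr_ge0 //.
rewrite sqr_absC sqrrD !real_normK ?num_real // addrAC lerDl.
by rewrite mulrn_wge0 // mulr_ge0.
Qed.

Lemma absC_cis t : absC (cis t) = 1.
Proof. by rewrite absCE /= cos2Dsin2 sqrtr1. Qed.

(** Radii of balls in [R[i]] are themselves elements of [R[i]]; positivity forces them to be
    real. *)
Lemma nbhsC_P z (A : set C) :
  nbhs z A <-> exists2 e : R, 0 < e & forall w, absC (w - z) < e -> A w.
Proof.
split.
  case/nbhs_ballP => e /= e0 zA; exists (complex.Re e).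
    by move: e0; rewrite ltcE => /andP[].
  move=> w wz; apply: zA; rewrite /ball /= distrC normC_absC ltcE /=.
  by move: e0; rewrite ltcE => /andP[/eqP -> _]; rewrite eqxx.
case=> e e0 zA; apply/nbhs_ballP; exists e%:C => /=; first by rewrite ltcR.
by move=> w; rewrite /ball /= distrC normC_absC ltcR => /zA.
Qed.

Lemma cvgC_P (T : Type) (F : set_system T) (FF : Filter F) (f : T -> C) z :
  f @ F --> z <->
  forall e : R, 0 < e -> \forall x \near F, absC (f x - z) < e.
Proof.
split=> [fz e e0|fz A /nbhsC_P [e e0 zA]].
  by apply: (fz [set w | absC (w - z) < e]); apply/nbhsC_P; exists e.
by near=> x; apply: zA; near: x; exact: fz.
Unshelve. all: by end_near. Qed.

Lemma continuousC_P (g : C -> R) z : {for z, continuous g} <->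
  forall e : R, 0 < e -> exists2 d : R, 0 < d &
    forall w, absC (w - z) < d -> `|g w - g z| < e.
Proof.
split=> [/cvgrPdist_lt gz e e0|H].
  have /nbhsC_P [d d0 H] := gz e e0.
  by exists d => // w /H /=; rewrite distrC.
apply/(@cvgrPdist_lt _ _ _ (nbhs z)) => e e0; apply/nbhsC_P.
by have [d d0 h] := H e e0; exists d => // w /h; rewrite distrC.
Qed.

Lemma lipschitz_continuousC (L : R) (g : C -> R) :
  (forall z w, `|g z - g w| <= L * absC (z - w)) -> continuous g.
Proof.
move=> gL z; apply/continuousC_P => e e0.
have L1 : 0 < `|L| + 1 by rewrite ltr_wpDl.
exists (e / (`|L| + 1)); first by rewrite divr_gt0.
move=> w; rewrite ltr_pdivlMr // => h; apply: le_lt_trans (gL _ _) _.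
apply: le_lt_trans h; rewrite mulrC ler_wpM2l ?absC_ge0 //.
by rewrite (le_trans (ler_norm _)) // lerDl.
Qed.

Lemma continuous_Re : continuous (@complex.Re R : C -> R).
Proof.
apply: (@lipschitz_continuousC 1) => z w; rewrite mul1r.
by apply: le_trans (Re_le_absC _); case: z w => [? ?] [? ?].
Qed.

Lemma continuous_Im : continuous (@complex.Im R : C -> R).
Proof.
apply: (@lipschitz_continuousC 1) => z w; rewrite mul1r.
by apply: le_trans (Im_le_absC _); case: z w => [? ?] [? ?].
Qed.

Lemma cvg_complex (T : Type) (F : set_system T) (FF : Filter F)
    (f g : T -> R) (a b : R) :
  f @ F --> a -> g @ F --> b ->
  (fun i : T => f i +i* g i : C) @ F --> (a +i* b : C).
Proof.
move=> /cvgrPdist_lt fa /cvgrPdist_lt gb; apply/cvgC_P => e e0; near=> x.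
apply: (le_lt_trans (absC_le_ReIm _)).
rewrite [e]splitr /=; apply: ltrD.
  by rewrite distrC; near: x; apply: fa; rewrite divr_gt0.
by rewrite distrC; near: x; apply: gb; rewrite divr_gt0.
Unshelve. all: by end_near. Qed.

Lemma continuous_cis : continuous (@cis R).
Proof.
by move=> t; apply: cvg_complex; [exact: continuous_cos|exact: continuous_sin].
Qed.

Lemma absC_lipschitz z w : `|absC z - absC w| <= 1 * absC (z - w).
Proof.
have := absCD (z - w) w; have := absCD (w - z) z.
rewrite !subrK (absC_distC w z) => h1 h2.
by rewrite mul1r ler_norml; apply/andP; split; lra.
Qed.

Lemma derivableC_continuous (f : C -> C) z :
  derivable f z 1 -> {for z, continuous f}.
Proof. by move/derivable1_diffP/differentiable_continuous. Qed.

Lemma derivableC_expansion (f : C -> C) z : derivable f z 1 ->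
  exists d : C, forall e : R, 0 < e -> exists2 r : R, 0 < r &
    forall w, absC (w - z) < r ->
      absC (f w - f z - d * (w - z)) <= e * absC (w - z).
Proof.
move=> df; exists ('D_1 f z) => e e0.
have /cvgC_P /(_ e e0) := df.
move=> /nbhsC_P [r r0 H].
exists r => // w wz; have [->|wneq] := eqVneq w z.
  by rewrite !subrr mulr0 subr0 absC0 mulr0.
have wz0 : w - z != 0 by rewrite subr_eq0.
have := H (w - z); rewrite subr0 => /(_ wz wz0).
rewrite /= /GRing.scale /= mulr1 subrK => h.
have -> : f w - f z - 'D_1 f z * (w - z) =
    ((w - z)^-1 * (f w - f z) - 'D_1 f z) * (w - z).
  by rewrite mulrBl mulrAC mulVf // mul1r.
by rewrite absCM ler_wpM2r ?absC_ge0 // ltW.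
Qed.

Lemma derivable_compC (f g : C -> C) z :
  derivable f z 1 -> derivable g (f z) 1 -> derivable (g \o f) z 1.
Proof.
move=> /derivable1_diffP df /derivable1_diffP dg; apply/derivable1_diffP.
exact (@differentiable_comp R[i] C C C f g z df dg).
Qed.

Lemma derivable_mulC (f g : C -> C) z :
  derivable f z 1 -> derivable g z 1 -> derivable (fun x : C => f x * g x : C) z 1.
Proof. by move=> df dg; exact (@derivableM R[i] C f g z 1 df dg). Qed.

Lemma derivable_linC (a b : C) z : derivable (fun x : C => a + b * x : C) z 1.
Proof.
have da : derivable (cst a : C -> C) z 1 by exact: derivable_cst.
have db : derivable (cst b : C -> C) z 1 by exact: derivable_cst.
have di : derivable (id : C -> C) z 1 by exact: derivable_id.
exact (@derivableD R[i] C C _ _ z 1 da (@derivableM R[i] C _ _ z 1 db di)).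
Qed.

Lemma derivable_invC (f : C -> C) z :
  derivable f z 1 -> f z != 0 -> derivable (fun x : C => (f x)^-1 : C) z 1.
Proof. by move=> df f0; exact (@derivableV R[i] C f z 1 f0 df). Qed.

End complex_modulus.

(** * Circular means of holomorphic functions *)

Section circle_mean.
Variable R : realType.
Local Notation C := (R[i]^o).
Implicit Types (z w : C).
Local Notation mu := (@lebesgue_measure R).

Lemma is_derive_expansion (f : R -> R) (x d : R) : is_derive x 1 f d ->
  forall e : R, 0 < e -> exists2 r : R, 0 < r &
    forall h, `|h| <= r -> `|f (x + h) - f x - d * h| <= e * `|h|.
Proof.
move=> [df <-] e e0.
have /cvgrPdist_le /(_ e e0) := df.
move=> /nbhs_ballP [r /= r0 H]; exists (r / 2); first by rewrite divr_gt0.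
move=> h hr; have [->|h0] := eqVneq h 0.
  by rewrite addr0 subrr mulr0 subr0 normr0 mulr0.
have := H h; rewrite /ball /= sub0r normrN.
have hr' : `|h| < r by rewrite (le_lt_trans hr) // ltr_pdivrMr // ltr_pMr ?ltr1n.
move=> /(_ hr' h0); rewrite /GRing.scale /= mulr1 (addrC h) => {}H.
have -> : f (x + h) - f x - 'D_1 f x * h =
    - ('D_1 f x - h^-1 * (f (x + h) - f x)) * h by field.
by rewrite normrM normrN ler_wpM2r.
Qed.

Lemma expR_cis_expansion (e : R) : 0 < e -> exists2 r : R, 0 < r &
  forall x y : R, `|x| <= r -> `|y| <= r ->
    absC ((expR x)%:C * cis y - 1 - (x +i* y) : C) <= e * (`|x| + `|y|).
Proof.
move=> e0.
(* The bounds [B1] to [B4] below add up to at most e' |x| + 5 e' |y|, so the factor 8 leaves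
   room. *)
pose e' := Num.min (e / 8) 1.
have e'0 : 0 < e' by rewrite lt_min ltr01 andbT divr_gt0.
have e'1 : e' <= 1 by rewrite ge_min lexx orbT.
have e'8 : 8 * e' <= e.
  by rewrite mulrC -ler_pdivlMr // ge_min lexx.
have [r1 r10 H1] := is_derive_expansion (is_derive_expR 0) e'0.
have [r2 r20 H2] := is_derive_expansion (is_derive_sin 0) e'0.
have [r3 r30 H3] := is_derive_expansion (is_derive_cos 0) e'0.
exists (Num.min (Num.min r1 r2) (Num.min r3 (e' / 2))).
  by rewrite !lt_min r10 r20 r30 divr_gt0.
move=> x y; rewrite !le_min => /andP[/andP[x1 x2] /andP[x3 xe]].
move=> /andP[/andP[y1 y2] /andP[y3 ye]].
move: (H1 _ x1) (H2 _ y2) (H3 _ y3).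
rewrite !add0r expR0 sin0 cos0 oppr0 mul0r !subr0 addr0 !mul1r.
move=> hx hs hc.
have cy : `|cos y| <= 1 by rewrite ler_norml cos_geN1 cos_le1.
have ex1 : `|expR x - 1| <= 2 * `|x|.
  rewrite -(subrK x (expR x - 1)); apply: (le_trans (ler_normD _ _)).
  have : e' * `|x| <= 1 * `|x| by rewrite ler_wpM2r.
  by move=> h; lra.
have ex : `|expR x| <= 2.
  rewrite -(subrK 1 (expR x)); apply: (le_trans (ler_normD _ _)).
  by rewrite normr1; lra.
apply: (le_trans (absC_le_ReIm _)).
have -> : complex.Re ((expR x)%:C * cis y - 1 - (x +i* y)) =
    (expR x - 1 - x) * cos y + (1 + x) * (cos y - 1).
  by rewrite /cis; simpc => /=; ring.
have -> : complex.Im ((expR x)%:C * cis y - 1 - (x +i* y)) =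
    expR x * (sin y - y) + (expR x - 1) * y.
  by rewrite /cis; simpc => /=; ring.
have B1 : `|(expR x - 1 - x) * cos y| <= e' * `|x|.
  by rewrite normrM -[leRHS]mulr1 ler_pM.
have B2 : `|(1 + x) * (cos y - 1)| <= 2 * (e' * `|y|).
  rewrite normrM ler_pM // (le_trans (ler_normD _ _)) // normr1; lra.
have B3 : `|expR x * (sin y - y)| <= 2 * (e' * `|y|).
  by rewrite normrM ler_pM.
have B4 : `|(expR x - 1) * y| <= e' * `|y|.
  by rewrite normrM ler_wpM2r // (le_trans ex1) //; lra.
have := ler_normD ((expR x - 1 - x) * cos y) ((1 + x) * (cos y - 1)).
have := ler_normD (expR x * (sin y - y)) ((expR x - 1) * y).
have : 8 * e' * (`|x| + `|y|) <= e * (`|x| + `|y|).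
  by rewrite ler_wpM2r // addr_ge0.
have : 0 <= e' * `|x| by rewrite mulr_ge0 // ltW.
have : 0 <= e' * `|y| by rewrite mulr_ge0 // ltW.
by lra.
Qed.

Definition polar (s t : R) : C := (expR s)%:C * cis t.

Lemma cisD (t u : R) : cis (t + u) = cis t * cis u :> C.
Proof. by rewrite /cis cosD sinD; simpc; rewrite (addrC (sin t * _)). Qed.

Lemma polarD s t x y : polar (s + x) (t + y) = polar s t * polar x y.
Proof.
by rewrite /polar expRD cisD rmorphM /= -!mulrA; congr (_ * _);
   rewrite mulrCA.
Qed.

Lemma absC_polar s t : absC (polar s t) = expR s.
Proof. by rewrite /polar absCM absC_real absC_cis mulr1 ger0_norm ?expR_ge0. Qed.

(** With Psi (e^(s+it)) = u + iv, the form is v ds + u dt, the imaginary part of (u + iv) d(s+it).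
    Its coefficients come from the derivative [D] in s+it by the Cauchy-Riemann equations. *)
Lemma polar_closed_form (Psi : C -> C) (s0 t0 : R) :
  derivable Psi (polar s0 t0) 1 ->
  closed_form_at (fun s t => complex.Im (Psi (polar s t)))
                 (fun s t => complex.Re (Psi (polar s t))) s0 t0.
Proof.
move=> /derivableC_expansion; set z0 := polar s0 t0 => -[d Hd].
pose D : C := d * z0.
exists (complex.Im D), (complex.Re D), (- complex.Im D) => e e0.
(* The expansion of [Psi] costs [e'] times twice [absC z0], that of the exponential [e'] times
   [absC D]; [K] bounds the sum of these factors and is positive. *)
pose K : R := absC z0 * 3 + absC d * absC z0 + 1.
have K0 : 0 < K by rewrite ltr_wpDl // addr_ge0 ?mulr_ge0 ?absC_ge0.
pose e' := Num.min (e / K) 1.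
have e'0 : 0 < e' by rewrite lt_min ltr01 andbT divr_gt0.
have e'1 : e' <= 1 by rewrite ge_min lexx orbT.
have e'K : e' * K <= e by rewrite -ler_pdivlMr // ge_min lexx.
have [r r0 Hr] := Hd _ e'0.
have [q q0 Hq] := expR_cis_expansion e'0.
have z0_gt0 : 0 < absC z0 by rewrite absC_polar expR_gt0.
(* With both increments at most r / (8 |z0|), the estimate [small] puts [polar s t] within r / 2 of
   [z0]. *)
exists (Num.min q (r / (absC z0 * 8))).
  by rewrite lt_min q0 divr_gt0 // mulr_gt0.
move=> s t; rewrite !le_min => /andP[sq sr] /andP[tq tr].
set x := s - s0; set y := t - t0.
have E : polar s t = z0 * polar x y.
  by rewrite /z0 -polarD /x /y !(addrC _ (_ - _)) !subrK.
have p1 := Hq _ _ sq tq; rewrite -/(polar x y) -/x -/y in p1.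
have nxy : absC (x +i* y : C) <= `|x| + `|y| by exact: absC_le_ReIm.
have p2 : absC (polar x y - 1) <= 2 * (`|x| + `|y|).
  rewrite -(subrK (x +i* y : C) (polar x y - 1)).
  apply: (le_trans (absCD _ _)).
  have : e' * (`|x| + `|y|) <= 1 * (`|x| + `|y|) by rewrite ler_wpM2r ?addr_ge0.
  by lra.
have dE : polar s t - z0 = z0 * (polar x y - 1).
  by rewrite E mulrBr mulr1.
have small : absC (polar s t - z0) <= absC z0 * (2 * (`|x| + `|y|)).
  by rewrite dE absCM ler_wpM2l // absC_ge0.
have smallr : absC (polar s t - z0) < r.
  apply: (le_lt_trans small).
  move: sr tr; rewrite -/x -/y !ler_pdivlMr ?mulr_gt0 // => sr tr.
  by have := mulr_gt0 z0_gt0 r0; lra.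
have main : absC (Psi (polar s t) - Psi z0 - D * (x +i* y)) <=
    e * (`|x| + `|y|).
  have -> : Psi (polar s t) - Psi z0 - D * (x +i* y) =
     (Psi (polar s t) - Psi z0 - d * (polar s t - z0)) +
     D * (polar x y - 1 - (x +i* y)).
    by rewrite dE /D; ring.
  apply: (le_trans (absCD _ _)).
  have h1 := le_trans (Hr _ smallr) (ler_wpM2l (ltW e'0) small).
  have h2 : absC (D * (polar x y - 1 - (x +i* y))) <=
      absC D * (e' * (`|x| + `|y|)) by rewrite absCM ler_wpM2l ?absC_ge0.
  apply: (le_trans (lerD h1 h2)).
  have : e' * K * (`|x| + `|y|) <= e * (`|x| + `|y|).
    by rewrite ler_wpM2r // addr_ge0.
  apply: le_trans; rewrite /K /D absCM.
  have : 0 <= e' * (`|x| + `|y|) by rewrite mulr_ge0 ?addr_ge0 // ltW.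
  have : 0 <= absC z0 * (e' * (`|x| + `|y|)).
    by rewrite mulr_ge0 ?absC_ge0 // mulr_ge0 ?addr_ge0 // ltW.
  by lra.
split.
- apply: le_trans main; apply: le_trans (Im_le_absC _).
  rewrite le_eqVlt; apply/orP; left; apply/eqP; congr `|_|.
  by case: (Psi (polar s t)) (Psi z0) D => [? ?] [? ?] [? ?] /=; ring.
- apply: le_trans main; apply: le_trans (Re_le_absC _).
  rewrite le_eqVlt; apply/orP; left; apply/eqP; congr `|_|.
  by case: (Psi (polar s t)) (Psi z0) D => [? ?] [? ?] [? ?] /=; ring.
Qed.

Definition circle_mean (Psi : C -> C) (r : R) : R :=
  \int[mu]_(t in `[0, 2 * pi]) complex.Re (Psi (r%:C * cis t)).

(** In logarithmic coordinates the annulus is the rectangle over [ln r1, ln r2] and [0, 2 pi]. The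
    sides t = 0 and t = 2 pi cancel by periodicity; the other two give the circular means. *)
Lemma circle_mean_const (Psi : C -> C) (r1 r2 : R) : 0 < r1 -> r1 <= r2 ->
  (forall z, r1 <= absC z <= r2 -> derivable Psi z 1) ->
  circle_mean Psi r1 = circle_mean Psi r2.
Proof.
move=> r10 r12 dPsi; have r20 := lt_le_trans r10 r12.
have := @goursat_rectangle R
  (fun s t => complex.Im (Psi (polar s t)))
  (fun s t => complex.Re (Psi (polar s t))) (ln r1) (ln r2 - ln r1) 0 (2 * pi).
rewrite /circulation (addrC (ln r1)) subrK add0r.
have -> : (fun x => complex.Im (Psi (polar x (2 * pi)))) =
          (fun x => complex.Im (Psi (polar x 0))).
  apply/funext => x; rewrite /polar /cis -[2 * pi]add0r.
  by rewrite mulr_natl cosD2pi sinD2pi.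
rewrite subrr add0r /polar !lnK ?posrE //.
move=> H; apply/esym/eqP; rewrite -subr_eq0; apply/eqP; apply: H.
- by rewrite subr_ge0 ler_ln.
- by rewrite mulr_ge0 // pi_ge0.
- move=> s t; rewrite (addrC (ln r1)) subrK => /andP[s1 s2] _.
  apply: polar_closed_form; apply: dPsi; rewrite absC_polar.
  by rewrite -ler_ln ?posrE ?expR_gt0 // -[X in _ && X]ler_ln ?posrE ?expR_gt0 //
    expRK s1.
Qed.

End circle_mean.

(** * The Poisson kernel *)

Section poisson.
Variable R : realType.
Local Notation C := (R[i]^o).
Implicit Types (z w eta zeta : C).
Local Notation mu := (@lebesgue_measure R).
Local Notation D := `[0, 2 * @pi R]%classic.

Lemma twopi_gt0 : 0 < 2 * pi :> R.
Proof. by rewrite mulr_gt0 // pi_gt0. Qed.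

Lemma Rintegral_circle_cst (r : R) : \int[mu]_(t in D) r = r * (2 * pi).
Proof.
by rewrite Rintegral_cst //= lebesgue_measure_itv /= lte_fin twopi_gt0 /= subr0.
Qed.

(** Logarithmic coordinates miss the centre, so the circle is shrunk to a radius [q] at which
    continuity brings [Psi] close to [Psi 0]. *)
Lemma circle_mean_center (Psi : C -> C) (r : R) : 0 < r ->
  (forall z, absC z <= r -> derivable Psi z 1) ->
  circle_mean Psi r = complex.Re (Psi 0) * (2 * pi).
Proof.
move=> r0 dPsi; apply/eqP; rewrite -subr_eq0 -normr_le0.
apply/ler_addgt0Pl => e e0; rewrite addr0.
have e'0 : 0 < e / (2 * pi) by rewrite divr_gt0 // twopi_gt0.
have /continuousC_P /(_ _ e'0) [d d0 Hd] :
    {for (0 : C), continuous (fun z => complex.Re (Psi z))}.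
  apply: continuous_comp; last exact: continuous_Re.
  by apply/derivableC_continuous/dPsi; rewrite absC0 ltW.
pose q := Num.min r (d / 2).
have q0 : 0 < q by rewrite lt_min r0 divr_gt0.
have qd : q < d by rewrite gt_min ltr_pdivrMr // ltr_pMr ?ltr1n // orbT.
have qr : q <= r by rewrite ge_min lexx.
rewrite -(@circle_mean_const R Psi q r q0 qr); last first.
  by move=> z /andP[_]; exact: dPsi.
have aq t : absC (q%:C * cis t : C) = q.
  by rewrite absCM absC_real absC_cis mulr1 gtr0_norm.
have := @Rintegral_itv_near_cst R (fun t => complex.Re (Psi (q%:C * cis t)))
  0 (2 * pi) (complex.Re (Psi 0)) (e / (2 * pi)) (ltW twopi_gt0).
rewrite subr0 divfK ?gt_eqF ?twopi_gt0 //; apply.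
- apply: continuous_itv_integrable => t _.
  apply: (@continuous_comp _ _ _ (fun t => q%:C * cis t : C)
    (fun z => complex.Re (Psi z))).
    by apply: cvgM; [exact: cvg_cst|exact: continuous_cis].
  apply: continuous_comp; last exact: continuous_Re.
  by apply/derivableC_continuous/dPsi; rewrite aq.
- by move=> t _; apply/ltW/Hd; rewrite subr0 aq.
Qed.

(** On the unit circle this is the conjugate of the usual kernel (w + z) / (w - z). It has the same
    real part there and is holomorphic in the circle variable [w] on the closed disc. *)
Definition herglotz z w : C := (1 + conjc z * w) * (1 - conjc z * w)^-1.

Definition poisson z w : R := complex.Re (herglotz z w).

Lemma poissonE z w : absC w = 1 ->
  poisson z w = (1 - absC z ^+ 2) / absC (1 - conjc z * w : C) ^+ 2.
Proof.
move=> w1; rewrite /poisson /herglotz.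
have {w1} : absC (conjc z * w : C) ^+ 2 = absC z ^+ 2.
  by rewrite absCM w1 mulr1 absC_conj.
move=> <-; rewrite !sqr_absC.
case: (conjc z * w) => x y /=.
by rewrite !(sub0r, add0r, opprK) sqrrN; set n := (_ + _ in X in _ / X); ring.
Qed.

Lemma absC_conjM_lt1 z w : absC z < 1 -> absC w <= 1 ->
  absC (conjc z * w : C) < 1.
Proof.
move=> z1 w1; rewrite absCM absC_conj (le_lt_trans _ z1) //.
by rewrite -[leRHS]mulr1 ler_wpM2l // absC_ge0.
Qed.

Lemma absC_1B_ge z : 1 - absC z <= absC (1 - z).
Proof. by have := absCD (1 - z) z; rewrite subrK absC1; lra. Qed.

Lemma herglotz_den_neq0 z w : absC z < 1 -> absC w <= 1 ->
  1 - conjc z * w != 0 :> C.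
Proof.
move=> z1 w1; rewrite -absC_gt0 (lt_le_trans _ (absC_1B_ge _)) // subr_gt0.
exact: absC_conjM_lt1.
Qed.

Lemma derivable_herglotz z w : absC z < 1 -> absC w <= 1 ->
  derivable (herglotz z) w 1.
Proof.
move=> z1 w1; apply: derivable_mulC; first exact: derivable_linC.
apply: derivable_invC; last exact: herglotz_den_neq0.
have := @derivable_linC R 1 (- conjc z) w.
by rewrite (_ : (fun _ => _) = (fun w : C => 1 - conjc z * w)) //;
   apply/funext => x; rewrite mulNr.
Qed.

Lemma herglotz0 z : herglotz z 0 = 1.
Proof. by rewrite /herglotz !mulr0 subr0 addr0 mul1r invr1. Qed.

Lemma herglotz_le z w : absC z < 1 -> absC w <= 1 ->
  absC (herglotz z w) <= 2 / (1 - absC z).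
Proof.
move=> z1 w1; rewrite /herglotz absCM absCV.
have a1 := absC_conjM_lt1 z1 w1.
have az : absC (conjc z * w : C) <= absC z.
  by rewrite absCM absC_conj -[leRHS]mulr1 ler_wpM2l // absC_ge0.
apply: ler_pM; rewrite ?invr_ge0 ?absC_ge0 //.
  by apply: (le_trans (absCD _ _)); rewrite absC1; lra.
rewrite lef_pV2 ?posrE ?subr_gt0 //; last first.
  by rewrite absC_gt0 herglotz_den_neq0.
by apply: (le_trans _ (absC_1B_ge _)); lra.
Qed.

Lemma poisson_ge0 z w : absC z < 1 -> absC w = 1 -> 0 <= poisson z w.
Proof.
move=> z1 w1; rewrite poissonE // divr_ge0 ?sqr_ge0 // subr_ge0.
by rewrite expr_le1 ?absC_ge0 // ltW.
Qed.

Lemma poisson_le z w : absC z < 1 -> absC w <= 1 ->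
  `|poisson z w| <= 2 / (1 - absC z).
Proof. by move=> z1 w1; apply: le_trans (Re_le_absC _) (herglotz_le _ _). Qed.

Lemma continuous_poisson z w : absC z < 1 -> absC w <= 1 ->
  {for w, continuous (poisson z)}.
Proof.
move=> z1 w1; apply: (@continuous_comp _ _ _ (herglotz z) (@complex.Re R)).
  exact/derivableC_continuous/derivable_herglotz.
exact: continuous_Re.
Qed.

Lemma continuous_poisson_cis z (t : R) : absC z < 1 ->
  {for t, continuous (fun t => poisson z (cis t))}.
Proof.
move=> z1; apply: (@continuous_comp _ _ _ (@cis R) (poisson z)).
  exact: continuous_cis.
by apply: continuous_poisson; rewrite ?absC_cis.
Qed.

Lemma poisson_mean z : absC z < 1 ->
  \int[mu]_(t in D) poisson z (cis t) = 2 * pi.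
Proof.
move=> z1; have := @circle_mean_center (herglotz z) 1 ltr01.
rewrite herglotz0 /= mul1r => H; rewrite -[RHS]H; last first.
  by move=> w w1; exact: derivable_herglotz.
by rewrite /circle_mean; apply: eq_Rintegral => t _; rewrite mul1r.
Qed.

(** Exchanges the direction of the base point with the circle variable, so that integrals over base
    points on a circle of radius r reduce to Poisson integrals. *)
Lemma poisson_sym (r : R) eta zeta : absC eta = 1 -> absC zeta = 1 ->
  poisson (r%:C * eta) zeta = poisson (r%:C * zeta) eta.
Proof.
move=> e1 z1; rewrite !poissonE // !absCM e1 z1; congr (_ / _ ^+ 2).
rewrite -absC_conj; congr absC.
case: eta zeta {e1 z1} => [a b] [c d]; apply/eqP; rewrite eq_complex /=.
by apply/andP; split; apply/eqP; ring.
Qed.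

Lemma conjc_realM (r : R) z : conjc (r%:C * z) = r%:C * conjc z :> C.
Proof.
by case: z => a b; apply/eqP; rewrite eq_complex /= !mul0r !(subr0, addr0)
  mulrN !eqxx.
Qed.

Lemma conj_unit eta : absC eta = 1 -> eta * conjc eta = 1.
Proof.
by move=> e1; rewrite -sqr_normc normC_absC e1 expr1n.
Qed.

(** The distance from [eta] to [zeta] is at most |eta - r zeta| + (1 - r), hence at most 2 |eta - r
    zeta|, and |eta - r zeta|^2 is the denominator of the kernel. This measures concentration
    without splitting the circle into a near and a far arc. *)
Lemma poisson_dist_le (r : R) eta zeta : 0 <= r < 1 ->
  absC eta = 1 -> absC zeta = 1 ->
  poisson (r%:C * eta) zeta * absC (eta - zeta) ^+ 2 <= 4 * (1 - r ^+ 2).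
Proof.
move=> /andP[r0 r1] e1 z1.
have E : absC (1 - conjc (r%:C * eta) * zeta : C) = absC (eta - r%:C * zeta).
  rewrite -[LHS]mul1r -e1 -absCM; congr absC.
  rewrite mulrBr mulr1; congr (_ - _).
  by rewrite conjc_realM mulrA mulrCA conj_unit // mulr1.
have n1 : 1 - r <= absC (eta - r%:C * zeta).
  have := absCD (eta - r%:C * zeta) (r%:C * zeta).
  by rewrite subrK e1 absCM z1 mulr1 absC_real ger0_norm //; lra.
have n2 : absC (eta - zeta) <= 2 * absC (eta - r%:C * zeta).
  have -> : eta - zeta = (eta - r%:C * zeta) + (r - 1)%:C * zeta.
    by rewrite rmorphB /= rmorph1; ring.
  apply: (le_trans (absCD _ _)).
  by rewrite [X in _ + X]absCM z1 mulr1 absC_real ltr0_norm; lra.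
have p0 : 0 < absC (eta - r%:C * zeta) by lra.
rewrite poissonE // E absCM absC_real e1 mulr1 ger0_norm //.
have -> : 4 * (1 - r ^+ 2) = (1 - r ^+ 2) / absC (eta - r%:C * zeta) ^+ 2 *
   (2 * absC (eta - r%:C * zeta)) ^+ 2.
  by field; rewrite gt_eqF.
rewrite ler_wpM2l // ?divr_ge0 ?sqr_ge0 ?subr_ge0 ?expr_le1 //; first exact: ltW.
by rewrite ler_pXn2r ?nnegrE ?absC_ge0 // mulr_ge0 ?absC_ge0.
Qed.

Lemma continuous_mulr_integrable (f g : R -> R) :
  (forall t, {for t, continuous f}) -> (forall t, {for t, continuous g}) ->
  mu.-integrable D (EFin \o (fun t => f t * g t)).
Proof.
move=> cf cg; apply: continuous_itv_integrable => t _.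
by apply: cvgM; [exact: cf|exact: cg].
Qed.

Lemma poisson_approx (L : R) (u : C -> R) : 0 < L ->
  (forall z w, `|u z - u w| <= L * absC (z - w)) ->
  forall e : R, 0 < e -> exists r : R, 0 < r < 1 /\
    forall zeta, absC zeta = 1 ->
    `|\int[mu]_(s in D) (poisson (r%:C * cis s) zeta * u (cis s))
       - 2 * pi * u zeta| <= e.
Proof.
move=> L0 uL e e0.
pose e' := e / (2 * pi); have e'0 : 0 < e' by rewrite divr_gt0 ?twopi_gt0.
(* With r = 1 - k and d = e' / (2 L), the term [M] below is at most 16 k L^2 / e', which this choice
   brings under e' / 2. *)
pose k := Num.min (1 / 2) (e' ^+ 2 / (32 * L ^+ 2)).
have k0 : 0 < k.
  by rewrite lt_min divr_gt0 //= divr_gt0 ?exprn_gt0 // mulr_gt0 ?exprn_gt0.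
have k12 : k <= 1 / 2 by rewrite ge_min lexx.
have kL : k * (32 * L ^+ 2) <= e' ^+ 2.
  by rewrite -ler_pdivlMr ?mulr_gt0 ?exprn_gt0 // ge_min lexx orbT.
pose r := 1 - k; exists r.
have r01 : 0 < r < 1 by rewrite /r; lra.
have r0 : 0 <= r < 1 by lra.
split=> // zeta z1.
have ar eta : absC eta = 1 -> absC (r%:C * eta) < 1.
  by move=> e1; rewrite absCM e1 mulr1 absC_real ger0_norm; lra.
have cu s : {for s, continuous (fun s => u (cis s))}.
  apply: (@continuous_comp _ _ _ (@cis R) u); first exact: continuous_cis.
  exact: (lipschitz_continuousC uL).
have cp s : {for s, continuous (fun s => poisson (r%:C * cis s) zeta)}.
  rewrite (_ : (fun s => _) = (fun s => poisson (r%:C * zeta) (cis s))).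
    by apply: continuous_poisson_cis; exact: ar.
  by apply/funext => s'; rewrite poisson_sym // absC_cis.
have pm : \int[mu]_(s in D) poisson (r%:C * cis s) zeta = 2 * pi.
  rewrite -[RHS](poisson_mean (ar _ z1)); apply: eq_Rintegral => s _.
  by rewrite poisson_sym // absC_cis.
have Ip : mu.-integrable D (EFin \o (fun s => poisson (r%:C * cis s) zeta)).
  by apply: continuous_itv_integrable => s _; exact: cp.
have Ipu : mu.-integrable D
   (EFin \o (fun s => poisson (r%:C * cis s) zeta * u (cis s))).
  exact: continuous_mulr_integrable.
have Ipc : mu.-integrable D
   (EFin \o (fun s => poisson (r%:C * cis s) zeta * u zeta)).
  by apply: continuous_mulr_integrable => // t; exact: cvg_cst.
rewrite -[X in _ - X * _]pm -RintegralZr // -RintegralB //.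
apply: (le_trans (le_normr_Rintegral _ _)) => //.
  exact: integrable_EFinB Ipu Ipc.
pose d := e' / (2 * L); have d0 : 0 < d by rewrite divr_gt0 // mulr_gt0.
pose M := 4 * (1 - r ^+ 2) * L / d.
have ME : M <= e' / 2.
  rewrite /M ler_pdivrMr // /d.
  have -> : e' / 2 * (e' / (2 * L)) = e' ^+ 2 / (4 * L) by field; rewrite gt_eqF.
  rewrite ler_pdivlMr ?mulr_gt0 //; apply: le_trans kL.
  have : 0 <= L ^+ 2 by rewrite exprn_ge0 // ltW.
  by rewrite /r; nra.
apply: (@le_trans _ _ (\int[mu]_(s in D)
    (poisson (r%:C * cis s) zeta * (L * d) + M))); last first.
  rewrite RintegralD //; last 2 first.
  - by apply: continuous_mulr_integrable => // t; exact: cvg_cst.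
  - by apply: continuous_itv_integrable => t _; exact: cvg_cst.
  rewrite RintegralZr // pm Rintegral_circle_cst.
  have -> : L * d = e' / 2 by rewrite /d; field; rewrite gt_eqF.
  have -> : e = e' * (2 * pi) by rewrite /e' divfK // gt_eqF // twopi_gt0.
  by have := twopi_gt0; nra.
apply: le_Rintegral => //.
- exact: (integrable_norm (integrable_EFinB Ipu Ipc)).
- apply: continuous_itv_integrable => t _; apply: cvgD; last exact: cvg_cst.
  by apply: cvgM; [exact: cp|exact: cvg_cst].
move=> s _; rewrite -mulrBr normrM ger0_norm; last first.
  by apply: poisson_ge0 => //; apply: ar; rewrite absC_cis.
set p := poisson _ _.
have p0 : 0 <= p by apply: poisson_ge0 => //; apply: ar; rewrite absC_cis.
have := poisson_dist_le r0 (absC_cis s) z1; rewrite -/p.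
have := uL (cis s) zeta; have := absC_ge0 (cis s - zeta).
move: (absC _) => x x0 ux px.
(* Trades the Lipschitz error, linear in the distance, for a small constant plus the square that
   [poisson_dist_le] controls. *)
have xd : x <= d + x ^+ 2 / d.
  rewrite -(ler_pM2r d0) mulrDl divfK ?gt_eqF //.
  have : 0 <= (x - d) ^+ 2 by rewrite sqr_ge0.
  have : 0 <= d * x by rewrite mulr_ge0 // ltW.
  by rewrite -expr2; nra.
apply: (le_trans (ler_wpM2l p0 ux)).
apply: (le_trans (ler_wpM2l p0 (ler_wpM2l (ltW L0) xd))).
rewrite mulrDr mulrDr lerD2l /M.
have -> : p * (L * (x ^+ 2 / d)) = p * x ^+ 2 * (L / d) by field; rewrite gt_eqF.
by rewrite -[leRHS]mulrA ler_wpM2r // divr_ge0 // ltW.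
Qed.

End poisson.

(** * Measurable circle maps *)

Section circle_maps.
Variable R : realType.
Local Notation C := (R[i]^o).
Implicit Types (z w eta zeta : C).
Local Notation mu := (@lebesgue_measure R).
Local Notation mble f := (measurable_fun (T := measurableTypeR R) (U := R) setT f).
Local Notation D := `[0, 2 * @pi R]%classic.

Lemma lebesgue_circle_lty : (mu D < +oo)%E.
Proof. by rewrite /= lebesgue_measure_itv /= lte_fin twopi_gt0 -EFinB ltry. Qed.

Lemma continuous_mble (f : R -> R) : continuous f -> mble f.
Proof. by move=> cf; exact (continuous_measurable_fun cf). Qed.

Lemma bounded_measurable_integrable (f : R -> R) (M : R) :
  mble f -> (forall t, D t -> `|f t| <= M) ->
  mu.-integrable D (EFin \o f).
Proof.
move=> mf fM; apply: measurable_bounded_integrable => //.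
- exact: lebesgue_circle_lty.
- exact: measurable_funTS.
- exists M; split; first exact: num_real.
  by move=> x Mx t Dt; exact: le_trans (fM _ Dt) (ltW Mx).
Qed.

Lemma bounded_ae_cvg_Rintegral (f_ : nat -> R -> R) (f : R -> R) (M : R) :
  (forall n, mble (f_ n)) -> mble f ->
  {ae mu, forall t, D t -> f_ ^~ t @ \oo --> f t} ->
  (forall n t, D t -> `|f_ n t| <= M) ->
  (fun n => \int[mu]_(t in D) f_ n t) @ \oo --> \int[mu]_(t in D) f t.
Proof.
move=> mf_ mf f_f f_M.
have Ic : mu.-integrable D (EFin \o cst M).
  by apply: continuous_itv_integrable => t _; exact: cvg_cst.
have [] := @dominated_convergence _ _ R mu D _ (fun n => EFin \o f_ n)
  (EFin \o f) (EFin \o cst M).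
- exact: measurable_itv.
- by move=> n; apply/measurable_EFinP; exact: measurable_funTS.
- by apply/measurable_EFinP; exact: measurable_funTS.
- have [N [mN N0 fN]] := f_f; exists N; split => // t nt; apply: fN => ft.
  apply: nt => Dt /=; apply: cvg_EFin; last exact: ft.
  by apply: nearW => n.
- exact: Ic.
- by apply: aeW => t n Dt /=; rewrite lee_fin; exact: f_M.
move=> If _ h.
by apply: fine_cvg; rewrite fineK //; exact: integrable_fin_num.
Qed.

Lemma bounded_cvg_Rintegral (f_ : nat -> R -> R) (f : R -> R) (M : R) :
  (forall n, mble (f_ n)) -> mble f ->
  (forall t, D t -> f_ ^~ t @ \oo --> f t) ->
  (forall n t, D t -> `|f_ n t| <= M) ->
  (fun n => \int[mu]_(t in D) f_ n t) @ \oo --> \int[mu]_(t in D) f t.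
Proof.
by move=> mf_ mf f_f; apply: bounded_ae_cvg_Rintegral => //; exact: aeW.
Qed.

(* The plane carries no sigma-algebra: measurability of a map into it is tested
   against real functions that are continuous at the points of the closed disc. *)
Definition disc_measurable (phi : R -> C) := forall g : C -> R,
  (forall z, absC z <= 1 -> {for z, continuous g}) ->
  mble (g \o phi).

Definition circle_map (phi : R -> C) :=
  (forall t, absC (phi t) = 1) /\ disc_measurable phi.

Lemma circle_map_cis : circle_map (@cis R).
Proof.
split=> [t|g cg]; first exact: absC_cis.
apply: continuous_mble => t; apply: continuous_comp.
  exact: continuous_cis.
by apply: cg; rewrite absC_cis.
Qed.

Lemma circle_map_measurable (phi : R -> C) (g : C -> R) :
  circle_map phi -> (forall z, absC z <= 1 -> {for z, continuous g}) ->
  mble (fun t => g (phi t)).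
Proof. by case=> _ /[apply]. Qed.

Lemma measurable_poisson (phi : R -> C) z : circle_map phi -> absC z < 1 ->
  mble (fun t => poisson z (phi t)).
Proof.
move=> cphi z1; apply: (circle_map_measurable cphi) => w w1.
exact: continuous_poisson.
Qed.

(** Serves joint measurability: the kernel becomes a measurable expression in the cosine and sine of
    [s] and the two real coordinates of [zeta]. *)
Lemma poisson_polarE (r s : R) zeta : 0 <= r < 1 -> absC zeta = 1 ->
  poisson (r%:C * cis s) zeta = (1 - r ^+ 2) *
    powR (1 + r ^+ 2 - 2 * r * (cos s * complex.Re zeta + sin s * complex.Im zeta))
      (-1).
Proof.
move=> /andP[r0 r1] z1.
rewrite poissonE // absCM absC_real absC_cis mulr1 ger0_norm //.
have E : absC (1 - conjc (r%:C * cis s) * zeta : C) ^+ 2 =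
  1 + r ^+ 2 - 2 * r * (cos s * complex.Re zeta + sin s * complex.Im zeta).
  rewrite sqr_absC; have := sqr_absC zeta; rewrite z1 expr1n.
  have := cos2Dsin2 s; case: zeta {z1} => a b /=.
  move: (cos s) (sin s) => x y xy ab.
  have xyab : (x ^+ 2 + y ^+ 2) * (a ^+ 2 + b ^+ 2) = 1 by rewrite xy -ab mulr1.
  transitivity (1 + r ^+ 2 * ((x ^+ 2 + y ^+ 2) * (a ^+ 2 + b ^+ 2))
    - 2 * r * (x * a + y * b)); first by ring.
  by rewrite xyab mulr1.
by rewrite -E powR_inv1 // sqr_ge0.
Qed.

(** Tonelli is applied on the product of two full lines; indicators restrict the integrals to one
    turn. *)
Lemma integral_indic_circle (h : R -> R) :
  (\int[mu]_y (h y * \1_D y)%:E = \int[mu]_(y in D) (h y)%:E)%E.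
Proof.
rewrite [RHS]integral_mkcond; apply: eq_integral => y _.
by rewrite /patch indicE; case: ifPn => yD; rewrite ?mulr1 ?mulr0.
Qed.

Lemma integral_indic_Rintegral (h : R -> R) :
  mu.-integrable D (EFin \o h) ->
  (\int[mu]_y (h y * \1_D y)%:E)%E = (\int[mu]_(y in D) h y)%:E.
Proof.
move=> Ih; rewrite /Rintegral fineK; last exact: integrable_fin_num.
exact: integral_indic_circle.
Qed.

(** * Tonelli's theorem for Poisson averages *)

Section swap.
Variables (phi : R -> C) (k : R -> R) (B r : R).
Hypotheses (cphi : circle_map phi) (mk : mble k).
Hypotheses (kB : forall t, 0 <= k t <= B) (r01 : 0 <= r < 1).

Let p1 s t : 0 <= poisson (r%:C * cis s) (phi t) <= 2 / (1 - r).
Proof.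
have a1 : absC (r%:C * cis s) = r.
  by rewrite absCM absC_real absC_cis mulr1 ger0_norm //; case/andP: r01.
have r1 : absC (r%:C * cis s) < 1 by rewrite a1; case/andP: r01.
rewrite poisson_ge0 //=; last exact: cphi.1.
by rewrite (le_trans (ler_norm _)) // -{2}a1 poisson_le // cphi.1.
Qed.

Let G (st : measurableTypeR R * measurableTypeR R) : R :=
  poisson (r%:C * cis st.1) (phi st.2) * k st.2.

Let mP : measurable_fun setT (fun st : measurableTypeR R * measurableTypeR R =>
  poisson (r%:C * cis st.1) (phi st.2)).
Proof.
have mRe : mble (fun t => complex.Re (phi t)).
  by apply: circle_map_measurable => // z _; exact: continuous_Re.
have mIm : mble (fun t => complex.Im (phi t)).
  by apply: circle_map_measurable => // z _; exact: continuous_Im.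
rewrite (_ : (fun st => _) = fun st => (1 - r ^+ 2) *
    powR (1 + r ^+ 2 - 2 * r * (cos st.1 * complex.Re (phi st.2) +
       sin st.1 * complex.Im (phi st.2))) (-1)); last first.
  by apply/funext => st; rewrite poisson_polarE // cphi.1.
apply: measurable_funM => //.
apply: (measurableT_comp (measurable_powR (-1))).
apply: measurable_funB => //; apply: measurable_funM => //.
apply: measurable_funD; apply: measurable_funM.
- by apply: (measurableT_comp (continuous_mble (@continuous_cos R))).
- exact: (measurableT_comp mRe).
- by apply: (measurableT_comp (continuous_mble (@continuous_sin R))).
- exact: (measurableT_comp mIm).
Qed.

Let mG : measurable_fun setT G.
Proof. by apply: measurable_funM => //; apply: measurableT_comp. Qed.

Let IG s : mu.-integrable D (EFin \o (fun t => G (s, t))).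
Proof.
apply: (@bounded_measurable_integrable _ (2 / (1 - r) * B)).
  exact: (measurableT_comp mG).
move=> t _; rewrite /G normrM /=; have /andP[p0 pB] := p1 s t.
have /andP[k0 kB'] := kB t.
by rewrite ler_pM // ger0_norm.
Qed.

Let mD : measurable_fun setT (\1_D : measurableTypeR R -> R).
Proof. exact: measurable_indic. Qed.

(** Up to the factor 2 pi, the Poisson integral at [r cis s] of the image under [phi] of the measure
    with density [k]. *)
Definition poisson_average (s : R) : R :=
  \int[mu]_(t in D) (poisson (r%:C * cis s) (phi t) * k t).

Lemma poisson_average_ge0 s : 0 <= poisson_average s.
Proof.
apply: Rintegral_ge0 => t _; have /andP[p0 _] := p1 s t.
by have /andP[k0 _] := kB t; rewrite mulr_ge0.
Qed.

Lemma poisson_average_le s : poisson_average s <= 2 / (1 - r) * B * (2 * pi).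
Proof.
rewrite -Rintegral_circle_cst; apply: le_Rintegral => //.
- exact: IG.
- by apply: continuous_itv_integrable => t _; exact: cvg_cst.
- move=> t _; have /andP[p0 pB] := p1 s t.
  by have /andP[k0 kB'] := kB t; rewrite ler_pM.
Qed.

Lemma measurable_poisson_average : mble poisson_average.
Proof.
apply/measurable_EFinP.
pose G1 (st : measurableTypeR R * measurableTypeR R) : \bar R :=
  (G st * \1_D st.2)%:E.
rewrite (_ : _ \o _ = fubini_F mu G1); last first.
  by apply/funext => s; rewrite /fubini_F /G1 /= integral_indic_Rintegral.
apply: measurable_fun_fubini_tonelli_F.
  apply/measurable_EFinP; apply: measurable_funM => //.
  exact: (measurableT_comp mD).
move=> [s t]; rewrite /G1 /G lee_fin /= indicE.
have /andP[p0 pB] := p1 s t; have /andP[k0 kB'] := kB t.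
by rewrite !mulr_ge0.
Qed.

Lemma measurable_poisson_integral (v : R -> R) (M : R) : mble v ->
  (forall s, 0 <= v s <= M) ->
  mble (fun t => \int[mu]_(s in D) (poisson (r%:C * cis s) (phi t) * v s)).
Proof.
move=> mv vM; apply/measurable_EFinP.
pose G3 (st : measurableTypeR R * measurableTypeR R) : \bar R :=
  (poisson (r%:C * cis st.1) (phi st.2) * v st.1 * \1_D st.1)%:E.
have Ipv t : mu.-integrable D
    (EFin \o (fun s => poisson (r%:C * cis s) (phi t) * v s)).
  apply: (@bounded_measurable_integrable _ (2 / (1 - r) * M)).
    apply: measurable_funM => //.
    exact: (measurableT_comp mP (pair2_measurable t)).
  move=> s _; have /andP[p0 pB] := p1 s t; have /andP[v0 vM'] := vM s.
  by rewrite ger0_norm ?mulr_ge0 // ler_pM.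
rewrite (_ : _ \o _ = fubini_G mu G3); last first.
  by apply/funext => t; rewrite /fubini_G /G3 /= integral_indic_Rintegral.
apply: measurable_fun_fubini_tonelli_G.
  apply/measurable_EFinP; apply: measurable_funM;
    last exact: (measurableT_comp mD).
  by apply: measurable_funM => //; exact: measurableT_comp.
move=> [s t]; rewrite /G3 lee_fin /= indicE.
have /andP[p0 pB] := p1 s t; have /andP[v0 vM'] := vM s.
by rewrite !mulr_ge0.
Qed.

Lemma poisson_average_swap (v : R -> R) (M : R) : mble v ->
  (forall s, 0 <= v s <= M) ->
  \int[mu]_(s in D) (poisson_average s * v s) =
  \int[mu]_(t in D)
    ((\int[mu]_(s in D) (poisson (r%:C * cis s) (phi t) * v s)) * k t).
Proof.
move=> mv vM.
pose H (st : measurableTypeR R * measurableTypeR R) : R := G st * v st.1.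
pose G2 (st : measurableTypeR R * measurableTypeR R) : \bar R :=
  (H st * \1_D st.1 * \1_D st.2)%:E.
have mH : measurable_fun setT H.
  by apply: measurable_funM => //; exact: measurableT_comp.
have H0 s t : 0 <= H (s, t).
  have /andP[p0 pB] := p1 s t; have /andP[k0 kB'] := kB t.
  by have /andP[v0 _] := vM s; rewrite /H /G /= !mulr_ge0.
have HM s t : `|H (s, t)| <= 2 / (1 - r) * B * M.
  rewrite ger0_norm //.
  have /andP[p0 pB] := p1 s t; have /andP[k0 kB'] := kB t.
  by have /andP[v0 vM'] := vM s; rewrite /H /G /= !ler_pM // mulr_ge0.
have mG2 : measurable_fun setT G2.
  apply/measurable_EFinP; apply: measurable_funM;
    last exact: (measurableT_comp mD).
  by apply: measurable_funM => //; exact: (measurableT_comp mD).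
have G20 st : (0 <= G2 st)%E.
  case: st => s t; rewrite /G2 lee_fin !indicE.
  by apply: mulr_ge0; [apply: mulr_ge0; [exact: H0|exact: ler0n]|exact: ler0n].
have IH1 s : mu.-integrable D (EFin \o (fun t => H (s, t) * \1_D s)).
  apply: (@bounded_measurable_integrable _ (2 / (1 - r) * B * M)).
    by apply: measurable_funM => //; exact: (measurableT_comp mH).
  move=> t _; rewrite indicE normrM; apply: le_trans (HM s t).
  by rewrite ler_piMr //; case: (_ \in _); rewrite ?normr1 ?normr0.
have IH3 s : mu.-integrable D (EFin \o (fun t => H (s, t))).
  apply: (@bounded_measurable_integrable _ (2 / (1 - r) * B * M)) => //.
  exact: (measurableT_comp mH).
have IH4 t : mu.-integrable D (EFin \o (fun s => H (s, t) * \1_D t)).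
  apply: (@bounded_measurable_integrable _ (2 / (1 - r) * B * M)).
    by apply: measurable_funM => //; exact: (measurableT_comp mH).
  move=> s _; rewrite indicE normrM; apply: le_trans (HM s t).
  by rewrite ler_piMr //; case: (_ \in _); rewrite ?normr1 ?normr0.
have Ipv t : mu.-integrable D
    (EFin \o (fun s => poisson (r%:C * cis s) (phi t) * v s)).
  apply: (@bounded_measurable_integrable _ (2 / (1 - r) * M)).
    apply: measurable_funM => //.
    exact: (measurableT_comp mP (pair2_measurable t)).
  move=> s _; have /andP[p0 pB] := p1 s t; have /andP[v0 vM'] := vM s.
  by rewrite ger0_norm ?mulr_ge0 // ler_pM.
have IH2 t : mu.-integrable D (EFin \o (fun s => H (s, t))).
  apply: (@bounded_measurable_integrable _ (2 / (1 - r) * B * M)) => //.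
  exact: (measurableT_comp mH).
have L s : (\int[mu]_t G2 (s, t) = (poisson_average s * v s * \1_D s)%:E)%E.
  rewrite (integral_indic_Rintegral (IH1 s)); congr EFin.
  rewrite RintegralZr //.
  by congr (_ * _); rewrite /poisson_average -RintegralZr //; exact: IG.
have L' t : (\int[mu]_s G2 (s, t) = ((\int[mu]_(s in D)
    (poisson (r%:C * cis s) (phi t) * v s)) * k t * \1_D t)%:E)%E.
  transitivity (\int[mu]_s (H (s, t) * \1_D t * \1_D s)%:E)%E.
    by apply: eq_integral => s _; rewrite /G2 /= mulrAC.
  rewrite (integral_indic_Rintegral (IH4 t)); congr EFin.
  rewrite RintegralZr //; congr (_ * _).
  rewrite -RintegralZr //.
  by apply: eq_Rintegral => s _; rewrite /H /G /= mulrAC.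
have := fubini_tonelli (m1 := mu) (m2 := mu) G2 mG2 G20.
under eq_integral do rewrite L.
under [in X in _ = X -> _]eq_integral do rewrite L'.
rewrite !integral_indic_circle => E.
by rewrite /Rintegral E.
Qed.


End swap.
End circle_maps.

(** * Weak convergence of boundary maps *)

Section weak_convergence.
Variable R : realType.
Local Notation C := (R[i]^o).
Implicit Types (z w eta zeta : C).
Local Notation mu := (@lebesgue_measure R).
Local Notation mble f := (measurable_fun (T := measurableTypeR R) (U := R) setT f).
Local Notation D := `[0, 2 * @pi R]%classic.

Lemma circle_map_lipschitz (phi : R -> C) (L : R) (u : C -> R) :
  circle_map phi -> (forall z w, `|u z - u w| <= L * absC (z - w)) ->
  mble (fun t => u (phi t)).
Proof.
move=> cphi uL; apply: circle_map_measurable => // z _.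
exact: (lipschitz_continuousC uL).
Qed.

(** After exchanging the integrals, [poisson_approx] applies at each point [phi t]. The radius
    depends on [u] and [e] only, so it can be fixed before a limit in [phi] is taken. *)
Lemma circle_average (L M : R) (u : C -> R) : 0 < L ->
  (forall z w, `|u z - u w| <= L * absC (z - w)) ->
  (forall z, 0 <= u z <= M) -> forall e, 0 < e ->
  exists r : R, 0 < r < 1 /\ forall (phi : R -> C) (k : R -> R) (B : R),
    circle_map phi -> mble k -> (forall t, 0 <= k t <= B) ->
    `|\int[mu]_(s in D) (poisson_average phi k r s * u (cis s)) -
      2 * pi * \int[mu]_(t in D) (u (phi t) * k t)| <=
    e * \int[mu]_(t in D) k t.
Proof.
move=> L0 uL uM e e0.
have [r [r01 Hr]] := poisson_approx L0 uL e0; exists r; split => //.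
move=> phi k B cphi mk kB.
have r01' : 0 <= r < 1 by case/andP: r01 => r0 ->; rewrite ltW.
have mv := circle_map_lipschitz (circle_map_cis R) uL.
have vM (s : R) : 0 <= u (cis s) <= M by [].
have mI := measurable_poisson_integral cphi r01' mv vM.
have mu_ := circle_map_lipschitz cphi uL.
rewrite (poisson_average_swap cphi mk kB r01' mv vM).
have Ik : mu.-integrable D (EFin \o k).
  apply: (@bounded_measurable_integrable _ _ B mk) => t _.
  by rewrite ger0_norm; case/andP: (kB t).
set I := fun t => \int[mu]_(s in D) (poisson (r%:C * cis s) (phi t) * u (cis s)).
have HI t : `|I t - 2 * pi * u (phi t)| <= e by apply: Hr; exact: cphi.1.
have IM t : `|I t| <= e + 2 * pi * M.
  rewrite -(subrK (2 * pi * u (phi t)) (I t)); apply: (le_trans (ler_normD _ _)).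
  have /andP[u0 uM'] := uM (phi t).
  by rewrite lerD // ger0_norm ?mulr_ge0 ?pi_ge0 // ler_wpM2l // mulr_ge0 ?pi_ge0.
have IIk : mu.-integrable D (EFin \o (fun t => I t * k t)).
  apply: (@bounded_measurable_integrable _ _ ((e + 2 * pi * M) * B)).
    exact: measurable_funM.
  move=> t _; rewrite normrM ler_pM // ger0_norm; by case/andP: (kB t).
have Iuk : mu.-integrable D (EFin \o (fun t => u (phi t) * k t)).
  apply: (@bounded_measurable_integrable _ _ (M * B)).
    exact: measurable_funM.
  move=> t _; have /andP[k0 kB'] := kB t; have /andP[u0 uM'] := uM (phi t).
  by rewrite normrM !ger0_norm // ler_pM.
have I2uk : mu.-integrable D (EFin \o (fun t => 2 * pi * (u (phi t) * k t))).
  apply: (@bounded_measurable_integrable _ _ (2 * pi * (M * B))).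
    by apply: measurable_funM => //; exact: measurable_funM.
  move=> t _; have /andP[k0 kB'] := kB t; have /andP[u0 uM'] := uM (phi t).
  have ? := pi_ge0 R.
  by rewrite ger0_norm ?mulr_ge0 // ler_wpM2l ?mulr_ge0 // ler_pM.
rewrite -RintegralZl // -RintegralB //.
apply: (le_trans (le_normr_Rintegral _ (integrable_EFinB IIk I2uk))) => //.
rewrite -RintegralZl //; apply: le_Rintegral => //.
- exact: (integrable_norm (integrable_EFinB IIk I2uk)).
- apply: (@bounded_measurable_integrable _ _ (e * B)).
    exact: measurable_funM.
  move=> t _; have /andP[k0 kB'] := kB t.
  by rewrite ger0_norm ?mulr_ge0 ?(ltW e0) // ler_wpM2l // ltW.
move=> t _; have /andP[k0 kB'] := kB t.
by rewrite mulrA -mulrBl normrM [X in _ * X]ger0_norm // ler_wpM2r.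
Qed.

(** At a fixed radius the Poisson averages tend boundedly to the constant [c], so their integrals
    against [u] converge; [circle_average] replaces them by integrals of [u] along the maps,
    uniformly in n. *)
Lemma weak_limit (phi_ : nat -> R -> C) (k : R -> R) (B c : R) :
  (forall n, circle_map (phi_ n)) -> mble k -> (forall t, 0 <= k t <= B) ->
  (forall w, absC w < 1 ->
    (fun n => \int[mu]_(t in D) (poisson w (phi_ n t) * k t)) @ \oo --> c) ->
  forall (L M : R) (u : C -> R), 0 < L ->
  (forall z w, `|u z - u w| <= L * absC (z - w)) ->
  (forall z, 0 <= u z <= M) ->
  (fun n => 2 * pi * \int[mu]_(t in D) (u (phi_ n t) * k t)) @ \oo -->
    c * \int[mu]_(s in D) u (cis s).
Proof.
move=> cphi mk kB plim L M u L0 uL uM.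
apply/cvgrPdist_le => e e0.
have K0 : 0 <= \int[mu]_(t in D) k t.
  by apply: Rintegral_ge0 => t _; case/andP: (kB t).
pose e' := e / 2 / (\int[mu]_(t in D) k t + 1).
have e'0 : 0 < e' by rewrite !divr_gt0 // ltr_wpDl.
have e'K : e' * \int[mu]_(t in D) k t <= e / 2.
  rewrite /e' -mulrA ler_piMr ?divr_ge0 ?(ltW e0) // mulrC.
  by rewrite ler_pdivrMr ?ltr_wpDl // mul1r lerDl.
have [r [r01 Hr]] := circle_average L0 uL uM e'0.
have r01' : 0 <= r < 1 by case/andP: r01 => r0 ->; rewrite ltW.
have mv := circle_map_lipschitz (circle_map_cis R) uL.
have lim : (fun n => \int[mu]_(s in D)
      (poisson_average (phi_ n) k r s * u (cis s))) @ \oo -->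
    c * \int[mu]_(s in D) u (cis s).
  rewrite -RintegralZl //; last first.
    apply: (@bounded_measurable_integrable _ _ M) => // t _.
    by rewrite ger0_norm; case/andP: (uM (cis t)).
  apply: (@bounded_cvg_Rintegral _ _ _ (2 / (1 - r) * B * (2 * pi) * M)).
  - move=> n; apply: measurable_funM => //.
    exact: measurable_poisson_average (cphi n) mk kB r01'.
  - exact: measurable_funM.
  - move=> s _; apply: cvgM; last exact: cvg_cst.
    apply: plim; rewrite absCM absC_cis mulr1 absC_real.
    by case/andP: r01' => r0 r1; rewrite ger0_norm.
  - move=> n s _; have /andP[u0 uM'] := uM (cis s).
    have a0 := poisson_average_ge0 (cphi n) kB r01' s.
    rewrite ger0_norm ?mulr_ge0 // ler_pM //.
    exact: poisson_average_le (cphi n) mk kB r01' s.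
move/cvgrPdist_le : lim => /(_ (e / 2)); rewrite divr_gt0 // => /(_ erefl).
apply: filterS => n lim.
rewrite [e]splitr -(subrK (\int[mu]_(s in D)
   (poisson_average (phi_ n) k r s * u (cis s))) (c * _)) -addrA.
apply: (le_trans (ler_normD _ _)); rewrite lerD //.
exact: le_trans (Hr _ _ _ (cphi n) mk kB) e'K.
Qed.

Lemma weak_eq (phi : R -> C) (k : R -> R) (B c : R) :
  circle_map phi -> mble k -> (forall t, 0 <= k t <= B) ->
  (forall w, absC w < 1 ->
    \int[mu]_(t in D) (poisson w (phi t) * k t) = c) ->
  forall (L M : R) (u : C -> R), 0 < L ->
  (forall z w, `|u z - u w| <= L * absC (z - w)) ->
  (forall z, 0 <= u z <= M) ->
  2 * pi * \int[mu]_(t in D) (u (phi t) * k t) =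
    c * \int[mu]_(s in D) u (cis s).
Proof.
move=> cphi mk kB pc L M u L0 uL uM.
have pc' w : absC w < 1 ->
    (fun _ : nat => \int[mu]_(t in D) (poisson w (phi t) * k t)) @ \oo --> c.
  by move=> w1; rewrite pc //; exact: cvg_cst.
have := weak_limit (fun=> cphi) mk kB pc' L0 uL uM.
by move=> /(cvg_lim (@Rhausdorff R)) <-; rewrite lim_cst.
Qed.

End weak_convergence.

(** * Outer separation on the circle *)

Section separation.
Variable R : realType.
Local Notation C := (R[i]^o).
Implicit Types (z w eta zeta : C).
Local Notation mu := (@lebesgue_measure R).
Local Notation mble f := (measurable_fun (T := measurableTypeR R) (U := R) setT f).
Local Notation D := `[0, 2 * @pi R]%classic.

Lemma cos_eq1 (x : R) : `|x| < 2 * pi -> cos x = 1 -> x = 0.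
Proof.
wlog x0 : x / 0 <= x.
  move=> H; have [/H//|x0] := leP 0 x; rewrite -normrN -cosN => h1 h2.
  by apply/eqP; rewrite -oppr_eq0; apply/eqP/H => //; rewrite oppr_ge0 ltW.
have pi0 := pi_gt0 R.
rewrite ger0_norm // => x2 cx; have [xpi|xpi] := leP x pi.
  apply: cos_inj; rewrite ?in_itv /= ?x0 ?xpi ?lexx ?ltW //.
  by rewrite cx cos0.
have cy : cos (2 * pi - x) = 1.
  by rewrite mulr_natl addrC cosD2pi cosN.
have : 2 * pi - x = 0.
  apply: cos_inj; rewrite ?cos0 // in_itv /=; last by rewrite lexx ltW.
  by apply/andP; split; lra.
by lra.
Qed.

Lemma cis_inj (s t : R) : `|s - t| < 2 * pi -> cis s = cis t :> C -> s = t.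
Proof.
move=> st [cst sst]; apply/eqP; rewrite -subr_eq0; apply/eqP; apply: cos_eq1 => //.
by rewrite cosB cst sst -!expr2 cos2Dsin2.
Qed.

(** * Distance to a set in the plane *)

Section distance.
Variable K : set C.
Hypothesis K0 : K !=set0.

Definition dist_to z : R := inf [set absC (z - w) | w in K].

Let has_inf_dist z : has_inf [set absC (z - w) | w in K].
Proof.
split; first by have [w Kw] := K0; exists (absC (z - w)), w.
by exists 0 => _ [w _ <-]; exact: absC_ge0.
Qed.

Lemma dist_to_ge0 z : 0 <= dist_to z.
Proof.
by apply: lb_le_inf; [case: (has_inf_dist z)|move=> _ [w _ <-]; exact: absC_ge0].
Qed.

Lemma dist_to_le z w : K w -> dist_to z <= absC (z - w).
Proof. by move=> Kw; apply: ge_inf; [case: (has_inf_dist z)|exists w]. Qed.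

Lemma dist_to_lipschitz z w : `|dist_to z - dist_to w| <= 1 * absC (z - w).
Proof.
have H a b : dist_to a - absC (a - b) <= dist_to b.
  apply: lb_le_inf; first by case: (has_inf_dist b).
  move=> _ [v Kv <-]; rewrite lerBlDr; apply: (le_trans (dist_to_le a Kv)).
  have -> : a - v = (b - v) + (a - b) by ring.
  exact: absCD.
have := H z w; have := H w z; rewrite (absC_distC w z) mul1r ler_norml.
by move=> h1 h2; apply/andP; split; lra.
Qed.

Lemma dist_to_gt0 z : closed K -> ~ K z -> 0 < dist_to z.
Proof.
move=> cK nKz; have : open (~` K) by exact: closed_openC.
rewrite openE => /(_ z nKz) /nbhsC_P [e e0 He].
apply: (lt_le_trans e0); apply: lb_le_inf; first by case: (has_inf_dist z).
move=> _ [w Kw <-]; rewrite leNgt; apply/negP; rewrite absC_distC.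
by move/He.
Qed.

End distance.

Lemma compact_closedC (K : set C) : compact K -> closed K.
Proof. by apply: compact_closed; exact: norm_hausdorff. Qed.

(** Outer regularity with the open set given as the positivity set of a Lipschitz function on the
    plane: [d] is the distance to the compact image of the complement of [U]. In this form the
    neighbourhood can be pulled back by any circle map. *)
Lemma circle_outer_separation (A : set (measurableTypeR R)) (e : R) :
  measurable A -> A `<=` D -> 0 < e ->
  exists d : C -> R, [/\ forall z w, `|d z - d w| <= 1 * absC (z - w),
    forall z, 0 <= d z, forall t, A t -> 0 < d (cis t) &
    (mu (D `&` [set t | (0 < d (cis t))%R]) <= mu A + e%:E)%E].
Proof.
move=> mA AD e0.
(* [cis] is injective on [0, 2 pi] except for its endpoints, which join [A]. *)
pose A' : set (measurableTypeR R) := A `|` [set 0; 2 * pi].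
have m01 : measurable ([set 0; 2 * pi] : set (measurableTypeR R)).
  by apply: measurableU; exact: measurable_set1.
have mA' : measurable A' by exact: measurableU.
have A'D : A' `<=` D.
  move=> t [/AD//|[]->] /=; rewrite in_itv /= lexx ?mulr_ge0 ?pi_ge0 //.
have muA' : (mu A' <= mu A)%E.
  apply: (le_trans (measureU2 _ _ _)) => //.
  have : mu [set 0; 2 * pi] = 0%E.
    by apply/countable_lebesgue_measure0/finite_set_countable.
  move=> h; rewrite -[leRHS]adde0 leeD //.
  by rewrite le_eqVlt; apply/orP; left; apply/eqP; exact: h.
have fA' : (mu A' < +oo)%E.
  by apply: (le_lt_trans _ (lebesgue_circle_lty R)); rewrite le_measure ?inE.
have [U [oU A'U UA']] := lebesgue_regularity_outer mA' fA' e0.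
have mU : measurable (U : set (measurableTypeR R)) by exact: open_measurable.
have muU : (mu U <= mu A + e%:E)%E.
  rewrite -(setDUK A'U); apply: (le_trans (measureU2 _ _ _)) => //.
    exact: measurableD.
  by apply: leeD => //; exact: ltW.
pose K : set C := @cis R @` (D `\` U).
have cK : compact K.
  apply: continuous_compact.
    by apply: continuous_subspaceT; exact: continuous_cis.
  rewrite setDE; apply: compact_closedI; first exact: segment_compact.
  exact: open_closedC.
(* When [U] covers the whole turn, no set is left to measure the distance to, and the constant 1
   serves. *)
have [K0|/set0P K0] := eqVneq K set0.
  exists (cst 1); split => [z w|z|t _|]; rewrite ?subrr ?normr0 ?mul1r ?absC_ge0 //.
  apply: le_trans muU; rewrite le_measure ?inE //.
    apply: measurableI => //.
    by rewrite (_ : [set t | _] = setT) //; apply/seteqP; split => // t _ /=.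
  move=> t [Dt _]; apply: contrapT => nU.
  have : K (cis t) by exists t.
  by rewrite K0.
have mpos : measurable (D `&` [set t | (0 < dist_to K (cis t))%R] :
    set (measurableTypeR R)).
  apply: measurableI => //.
  have := circle_map_lipschitz (circle_map_cis R) (dist_to_lipschitz K0).
  move=> /(_ measurableT _ (measurable_itv `]0, +oo[)); rewrite setTI.
  congr measurable; apply/seteqP.
  by split => t /=; rewrite in_itv /= andbT.
exists (dist_to K); split.
- exact: dist_to_lipschitz.
- exact: dist_to_ge0.
- move=> t At; apply: dist_to_gt0 => //; first exact: compact_closedC.
  move=> [s [Ds nUs] st].
  have Ut : U t by apply: A'U; left.
  have s0 : s != 0 by apply/eqP => s0; apply/nUs/A'U; right; left.
  have s1 : s != 2 * pi by apply/eqP => s0'; apply/nUs/A'U; right; right.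
  have := AD _ At; move: Ds => /=; rewrite !in_itv /= => /andP[s2 s3] /andP[t2 t3].
  have s4 : 0 < s by rewrite lt_neqAle eq_sym s0.
  have s5 : s < 2 * pi by rewrite lt_neqAle s1.
  have : s = t by apply: cis_inj => //; rewrite ltr_norml; apply/andP; split; lra.
  by move=> E; apply: nUs; rewrite E.
- apply: le_trans muU; rewrite le_measure ?inE // => t [Dt /= dt].
  apply: contrapT => nU; move: dt; apply/negP; rewrite -leNgt.
  have Kt : K (cis t) by exists t.
  by apply: (le_trans (dist_to_le K0 _ Kt)); rewrite subrr absC0.
Qed.

End separation.

(** * Null sets *)

Section null_sets.
Variable R : realType.
Local Notation C := (R[i]^o).
Implicit Types (z w eta zeta : C).
Local Notation mu := (@lebesgue_measure R).
Local Notation mble f := (measurable_fun (T := measurableTypeR R) (U := R) setT f).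
Local Notation D := `[0, 2 * @pi R]%classic.

Lemma archi_invS (e : R) : 0 < e -> exists m : nat, m.+1%:R^-1 <= e.
Proof.
move=> e0; exists (Num.bound e^-1); rewrite invf_ple ?posrE //.
apply: (le_trans (ltW (archi_boundP _))); first by rewrite invr_ge0 ltW.
by rewrite ler_nat leqW.
Qed.

(** * Lipschitz approximation of the indicator of a positivity set *)

Section cutoff.
Variable d : C -> R.
Hypotheses (dL : forall z w, `|d z - d w| <= 1 * absC (z - w)).
Hypotheses (d0 : forall z, 0 <= d z).

Definition cutoff (n : nat) z : R := Num.min 1 (n.+1%:R * d z).

Lemma cutoff01 n z : 0 <= cutoff n z <= 1.
Proof. by rewrite ge_min lexx le_min ler01 mulr_ge0. Qed.

Lemma cutoff_lipschitz n z w :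
  `|cutoff n z - cutoff n w| <= n.+1%:R * absC (z - w).
Proof.
have H a b : cutoff n a - cutoff n b <= n.+1%:R * absC (a - b).
  have := dL a b; rewrite mul1r ler_norml => /andP[_ h].
  have := ler_wpM2l (ler0n R n.+1) h; rewrite mulrBr => {}h.
  have p : 0 <= n.+1%:R * absC (a - b) by rewrite mulr_ge0 ?absC_ge0.
  rewrite lerBlDr /cutoff; set x := _ * d a in h *; set y := _ * d b in h *.
  by rewrite minEle minEle; case: ifPn => hx; case: ifPn => hy;
    move: hx hy; rewrite -?ltNge => hx hy; lra.
have := H z w; have := H w z; rewrite (absC_distC w z) ler_norml.
by move=> h1 h2; apply/andP; split; lra.
Qed.

Lemma cutoff_cvg z : (fun n => cutoff n z) @ \oo --> ((0 < d z)%R%:R : R).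
Proof.
have [dz|dz] := ltP 0 (d z); last first.
  rewrite (_ : (fun n => _) = (fun=> 0)); first exact: cvg_cst.
  apply/funext => n; rewrite /cutoff.
  by have /eqP -> : d z == 0; rewrite ?eq_le ?dz ?d0 // mulr0 min_r.
apply/cvgrPdist_lt => e e0; exists (Num.bound (d z)^-1) => // n /= hn.
rewrite /cutoff min_l ?subrr ?normr0 // -ler_pdivrMr // mul1r.
apply: (le_trans (ltW (archi_boundP _))); first by rewrite invr_ge0 ltW.
by rewrite ler_nat leqW.
Qed.

Variables (phi : R -> C) (k : R -> R) (B : R).
Hypotheses (cphi : circle_map phi) (mk : mble k) (kB : forall t, 0 <= k t <= B).

Lemma measurable_cutoff n : mble (fun t => cutoff n (phi t)).
Proof. exact: circle_map_lipschitz cphi (@cutoff_lipschitz n). Qed.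

Lemma measurable_positivity : mble (fun t => (0 < d (phi t))%R%:R).
Proof.
apply: (measurable_fun_cvg (h := fun n t => cutoff n (phi t))).
  exact: measurable_cutoff.
by move=> t _; exact: cutoff_cvg.
Qed.

Lemma cutoff_integral_cvg :
  (fun n => \int[mu]_(t in D) (cutoff n (phi t) * k t)) @ \oo -->
  \int[mu]_(t in D) ((0 < d (phi t))%R%:R * k t).
Proof.
apply: (@bounded_cvg_Rintegral _ _ _ B).
- by move=> n; apply: measurable_funM => //; exact: measurable_cutoff.
- by apply: measurable_funM => //; exact: measurable_positivity.
- by move=> t _; apply: cvgM; [exact: cutoff_cvg|exact: cvg_cst].
- move=> n t _; have /andP[c0 c1] := cutoff01 n (phi t).
  have /andP[k0 kB'] := kB t.
  by rewrite ger0_norm ?mulr_ge0 // -[leRHS]mul1r ler_pM.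
Qed.

End cutoff.

Lemma Rintegral_bool (b : R -> bool) :
  mble (fun t => (b t)%:R : R) ->
  measurable (D `&` [set t | b t] : set (measurableTypeR R)) /\
  (mu (D `&` [set t | b t]) = (\int[mu]_(t in D) (b t)%:R)%:E)%E.
Proof.
move=> mb.
have E : (fun t => (b t)%:R : R) = \1_[set t | b t].
  apply/funext => t; rewrite indicE.
  by have -> : (t \in [set t | b t]) = b t by apply/idP/idP; rewrite inE.
have mB : measurable ([set t | b t] : set (measurableTypeR R)).
  have := mb; rewrite E => h.
  by apply/(@measurable_indicP _ (measurableTypeR R) R).
have mDB : measurable (D `&` [set t | b t] : set (measurableTypeR R)).
  exact: measurableI.
have -> : \int[mu]_(t in D) (b t)%:R = \int[mu]_(t in D) \1_[set t | b t] t.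
  by rewrite -E.
split => //; rewrite /Rintegral integral_indic // fineK 1?setIC //.
rewrite ge0_fin_numE //.
by apply: (le_lt_trans _ (lebesgue_circle_lty R)); rewrite le_measure ?inE //;
  rewrite setIC.
Qed.

(** Constant Poisson integrals make [phi] preserve arc length on Lipschitz functions, hence on
    positivity sets. The preimage lies in positivity sets of measure at most 1 / (m + 1) for every
    m. This ensures that the radial limits of the next inner function exist at almost every
    [phi t]. *)
Lemma circle_map_null_preimage (phi : R -> C) (N : set (measurableTypeR R)) :
  circle_map phi ->
  (forall w, absC w < 1 -> \int[mu]_(t in D) poisson w (phi t) = 2 * pi) ->
  N `<=` D -> mu.-negligible N ->
  mu.-negligible [set t | D t /\ exists2 s, N s & phi t = cis s].
Proof.
move=> cphi pphi ND [N' [mN' N'0 NN']].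
pose A : set (measurableTypeR R) := N' `&` D.
have mA : measurable A by exact: measurableI.
have A0 : mu A = 0%E.
  apply/eqP; rewrite -measure_le0 -N'0 le_measure ?inE //.
  by move=> t [].
have AD : A `<=` D by move=> t [].
have /choice [d Hd] : forall m : nat, exists d : C -> R,
    [/\ forall z w, `|d z - d w| <= 1 * absC (z - w),
    forall z, 0 <= d z, forall t, A t -> 0 < d (cis t) &
    (mu (D `&` [set t | (0 < d (cis t))%R]) <= mu A + (m.+1%:R^-1)%:E)%E].
  by move=> m; apply: circle_outer_separation => //; rewrite invr_gt0.
pose W m : set (measurableTypeR R) := D `&` [set t | 0 < d m (phi t)].
have HW m : measurable (W m) /\ (mu (W m) <= (m.+1%:R^-1)%:E)%E.
  have [dL d0 dA dmu] := Hd m.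
  have [mW muW] := Rintegral_bool (measurable_positivity dL d0 cphi).
  split=> //; rewrite muW.
  have mc := measurable_positivity dL d0 (circle_map_cis R).
  have [_ muc] := Rintegral_bool mc.
  move: dmu; rewrite A0 add0e muc !lee_fin; apply: le_trans.
  have k1 (t : R) : 0 <= (1 : R) <= 1 by rewrite ler01 lexx.
  have m1 : mble (fun=> 1 : R) by exact: measurable_cst.
  have := cutoff_integral_cvg dL d0 cphi m1 k1.
  have := cutoff_integral_cvg dL d0 (circle_map_cis R) m1 k1.
  (* By [weak_eq] with density 1 and constant 2 pi, the cutoffs have equal integrals along [phi] and
     along [cis]; in the limit the two positivity sets have equal measure. *)
  have -> : (fun n => \int[mu]_(t in D) (cutoff (d m) n (cis t) * 1)) =
      (fun n => \int[mu]_(t in D) (cutoff (d m) n (phi t) * 1)).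
    apply/funext => n.
    have tp : 2 * pi != 0 :> R by rewrite gt_eqF // twopi_gt0.
    apply: (mulfI tp); apply/esym; rewrite -[RHS]/(2 * pi * _).
    rewrite (@weak_eq R phi (fun=> 1) 1 (2 * pi) cphi m1 k1 _ n.+1%:R 1) //.
    - by congr (_ * _); apply: eq_Rintegral => t _; rewrite mulr1.
    - move=> w w1; rewrite -[RHS](pphi _ w1).
      by apply: eq_Rintegral => t _; rewrite mulr1.
    - exact: cutoff_lipschitz.
    - exact: cutoff01.
  move=> /(cvg_lim (@Rhausdorff R)) l1 /(cvg_lim (@Rhausdorff R)) l2.
  move: l1; rewrite l2.
  under eq_Rintegral do rewrite mulr1.
  by under [in X in _ = X -> _]eq_Rintegral do rewrite mulr1; move=> ->.
exists (\bigcap_m W m); split.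
- by apply: bigcap_measurable => // m _; have [] := HW m.
- apply/eqP; rewrite -measure_le0; apply/lee_addgt0Pr => e e0; rewrite add0e.
  have [m me] := archi_invS e0.
  apply: (@le_trans _ _ (mu (W m))).
    rewrite le_measure ?inE //.
    - by apply: bigcap_measurable => // i _; have [] := HW i.
    - by have [] := HW m.
    - by move=> t; apply.
  by have [_ h] := HW m; apply: (le_trans h); rewrite lee_fin.
- move=> t [Dt [s Ns ts]] m _; split => //=.
  by have [_ _ dA _] := Hd m; rewrite ts; apply: dA; split; [exact: NN'|exact: ND].
Qed.

(** The bound on Poisson integrals says weakly that the indicator of [A] is at most [c]. Tested
    against functions close to that indicator from above, it yields mu A <= c (mu A) up to a small
    error. *)
Lemma poisson_density (A : set (measurableTypeR R)) (c : R) :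
  measurable A -> A `<=` D -> 0 <= c < 1 ->
  (forall z, absC z < 1 ->
    \int[mu]_(t in D) (poisson z (cis t) * \1_A t) <= c * (2 * pi)) ->
  mu A = 0%E.
Proof.
move=> mA AD /andP[c0 c1] Ac.
have mk : mble (\1_A : R -> R) by exact: measurable_indic.
have kB t : 0 <= (\1_A : R -> R) t <= 1.
  by rewrite indicE; case: (t \in A); rewrite /= ler01 lexx.
pose a := \int[mu]_(t in D) (\1_A : R -> R) t.
have muA : (mu A = a%:E)%E.
  rewrite /a /Rintegral integral_indic // (setIidl AD) fineK //.
  rewrite ge0_fin_numE //.
  by apply: (le_lt_trans _ (lebesgue_circle_lty R)); rewrite le_measure ?inE.
have a0 : 0 <= a by apply: Rintegral_ge0 => t _; case/andP: (kB t).
rewrite muA; congr EFin; apply/eqP; rewrite eq_le a0 andbT.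
(* The weak form of the bound; the error e / (a + 1) per unit mass costs at most [e] in total. *)
have H (L M : R) (u : C -> R) : 0 < L ->
    (forall z w, `|u z - u w| <= L * absC (z - w)) ->
    (forall z, 0 <= u z <= M) ->
    \int[mu]_(t in D) (u (cis t) * \1_A t) <= c * \int[mu]_(t in D) (u (cis t) * 1).
  move=> L0 uL uM; under [in leRHS]eq_Rintegral do rewrite mulr1.
  rewrite -(ler_pM2l (twopi_gt0 R)); apply/ler_addgt0Pr => e e0.
  have e'0 : 0 < e / (a + 1) by rewrite divr_gt0 // ltr_wpDl.
  have [r [r01 Hr]] := circle_average L0 uL uM e'0.
  have r01' : 0 <= r < 1 by case/andP: r01 => r0 ->; rewrite ltW.
  have := Hr _ _ _ (circle_map_cis R) mk kB; rewrite ler_norml => /andP[h _].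
  have mv := circle_map_lipschitz (circle_map_cis R) uL.
  have mav := measurable_poisson_average (circle_map_cis R) mk kB r01'.
  have av0 := poisson_average_ge0 (circle_map_cis R) kB r01'.
  have avc s : poisson_average (@cis R) \1_A r s <= c * (2 * pi).
    apply: Ac; rewrite absCM absC_cis mulr1 absC_real.
    by case/andP: r01' => r0 r1; rewrite ger0_norm.
  have le : \int[mu]_(s in D) (poisson_average (@cis R) \1_A r s * u (cis s)) <=
      \int[mu]_(s in D) (c * (2 * pi) * u (cis s)).
    apply: le_Rintegral => //.
    - apply: (@bounded_measurable_integrable _ _ (c * (2 * pi) * M)).
        exact: measurable_funM.
      move=> s _; have /andP[u0 uM'] := uM (cis s).
      by rewrite ger0_norm ?mulr_ge0 // ler_pM.
    - apply: (@bounded_measurable_integrable _ _ (c * (2 * pi) * M)).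
        exact: measurable_funM.
      move=> s _; have /andP[u0 uM'] := uM (cis s).
      have cp : 0 <= c * (2 * pi) by rewrite !mulr_ge0 ?pi_ge0.
      by rewrite ger0_norm ?(mulr_ge0 cp u0) // ler_wpM2l.
    - by move=> s _; have /andP[u0 _] := uM (cis s); rewrite ler_wpM2r.
  move: le; rewrite RintegralZl //; last first.
    apply: (@bounded_measurable_integrable _ _ M) => // s _.
    by have /andP[u0 uM'] := uM (cis s); rewrite ger0_norm.
  have ea : e / (a + 1) * a <= e.
    by rewrite -mulrA ler_piMr ?(ltW e0) // mulrC ler_pdivrMr ?ltr_wpDl //
      mul1r lerDl.
  rewrite -/a in h; lra.
suff Ha (e : R) : 0 < e -> a <= e.
  by apply/ler_addgt0Pr => e e0; rewrite add0r; exact: Ha.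
(* With this excess, a <= c (a + e (1 - c)) rearranges to a (1 - c) <= e c (1 - c), and 1 - c
   cancels. *)
move=> e0; have e'0 : 0 < e * (1 - c) by rewrite mulr_gt0 // subr_gt0.
have [d [dL d0 dA dmu]] := circle_outer_separation mA AD e'0.
have k1 (t : R) : 0 <= (1 : R) <= 1 by rewrite ler01 lexx.
have m1 : mble (fun=> 1 : R) by exact: measurable_cst.
have l1 := cutoff_integral_cvg dL d0 (circle_map_cis R) mk kB.
have l2 := cutoff_integral_cvg dL d0 (circle_map_cis R) m1 k1.
have nn : \forall n \near \oo, \int[mu]_(t in D) (cutoff d n (cis t) * \1_A t) <=
    c * \int[mu]_(t in D) (cutoff d n (cis t) * 1).
  apply: nearW => n.
  by apply: (@H n.+1%:R 1); [|exact: cutoff_lipschitz|exact: cutoff01].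
have : \int[mu]_(t in D) ((0 < d (cis t))%R%:R * \1_A t) <=
    c * \int[mu]_(t in D) ((0 < d (cis t))%R%:R * 1).
  exact: ler_cvg_to l1 (cvgM (cvg_cst c) l2) nn.
have -> : \int[mu]_(t in D) ((0 < d (cis t))%R%:R * \1_A t) = a.
  apply: eq_Rintegral => t _; rewrite indicE.
  have [tA|] := boolP (t \in A); last by rewrite mulr0.
  by rewrite dA ?mulr1 //; rewrite inE in tA.
have [_ ] := Rintegral_bool (measurable_positivity dL d0 (circle_map_cis R)).
under [in X in _ -> X]eq_Rintegral do rewrite mulr1.
move=> E; move: dmu; rewrite E muA -EFinD lee_fin.
set b := \int[mu]_(t in D) _ => ba ab.
have h1 : c * b <= c * (a + e * (1 - c)) by rewrite ler_wpM2l.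
have h2 : a <= c * (a + e * (1 - c)) := le_trans ab h1.
have : a * (1 - c) <= e * c * (1 - c) by clear k1; lra.
rewrite ler_pM2r ?subr_gt0 // => h; apply: (le_trans h).
by rewrite ler_piMr ?(ltW e0) // ltW.
Qed.

End null_sets.

(** * Transport of Poisson integrals to the boundary *)

Section transport.
Variable R : realType.
Local Notation C := (R[i]^o).
Implicit Types (z w eta zeta : C) (F : C -> C).
Local Notation mu := (@lebesgue_measure R).
Local Notation mble f := (measurable_fun (T := measurableTypeR R) (U := R) setT f).
Local Notation D := `[0, 2 * @pi R]%classic.

Lemma cis_surj zeta : absC zeta = 1 -> exists2 s : R, `|s| <= pi & zeta = cis s.
Proof.
move=> z1; have := sqr_absC zeta; rewrite z1 expr1n.
have := Re_le_absC zeta; rewrite z1 ler_norml; case: zeta {z1} => a b /= a1 ab.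
have acosI : a \in `[-1, 1] by rewrite in_itv.
have sa : sin (acos a) = `|b|.
  by rewrite sin_acos // -sqrtr_sqr; congr Num.sqrt; rewrite ab; ring.
have p0 := acos_ge0 a1; have p1 := acos_lepi a1.
have [b0|b0] := leP 0 b.
  exists (acos a); first by rewrite ger0_norm.
  by rewrite /cis acosK // sa ger0_norm.
exists (- acos a); first by rewrite normrN ger0_norm.
by rewrite /cis cosN sinN acosK // sa ltr0_norm // opprK.
Qed.

Lemma cisD2pi (s : R) : cis (s + 2 * pi) = cis s :> C.
Proof. by rewrite /cis mulr_natl cosD2pi sinD2pi. Qed.

Lemma cis_surj_2pi zeta : absC zeta = 1 ->
  exists2 s : R, 0 <= s < 2 * pi & zeta = cis s.
Proof.
move=> /cis_surj [s]; rewrite ler_norml => /andP[s1 s2] ->; have pi0 := pi_gt0 R.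
have [s0|s0] := leP 0 s; first by exists s => //; apply/andP; split; lra.
by exists (s + 2 * pi); rewrite ?cisD2pi //; apply/andP; split; lra.
Qed.

(** Obtained from the Poisson kernel by replacing conj w with 1 / w: on the unit circle, w - z is
    [w] times the conjugate of 1 - conj z w. *)
Definition poisson_hol z w : C :=
  (1 - z * conjc z) * w * ((w - z) * (1 - conjc z * w))^-1.

Lemma poisson_holE z w : absC w = 1 -> poisson_hol z w = (poisson z w)%:C.
Proof.
move=> w1; have w0 : w != 0 by rewrite -absC_gt0 w1.
have zz : (1 - absC z ^+ 2)%:C = 1 - z * conjc z.
  by rewrite rmorphB rmorph1 rmorphXn /= -normC_absC sqr_normc.
have divC (x y : R) : (x / y)%:C = x%:C * (y%:C)^-1 :> C.
  by rewrite rmorphM fmorphV.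
rewrite poissonE // divC zz rmorphXn /= -normC_absC sqr_normc.
rewrite /poisson_hol -mulrA; congr (_ * _).
set a := 1 - conjc z * w.
have -> : w - z = w * conjc a.
  rewrite /a rmorphB rmorph1 rmorphM /= conjcK mulrBr mulr1 mulrCA.
  by rewrite conj_unit // mulr1.
by rewrite -mulrA invfM mulrA mulfV // mul1r mulrC.
Qed.

Lemma poisson_hol0 w : w != 0 -> poisson_hol 0 w = 1.
Proof.
by move=> w0; rewrite /poisson_hol conjc0 !mul0r !subr0 mul1r mulr1 mulfV.
Qed.

Lemma derivable_poisson_hol z w : absC z < absC w -> absC w <= 1 ->
  derivable (poisson_hol z) w 1.
Proof.
move=> zw w1; have z1 := lt_le_trans zw w1.
apply: derivable_mulC.
  have := @derivable_linC R 0 (1 - z * conjc z) w.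
  by rewrite (_ : (fun _ => _) = (fun w : C => (1 - z * conjc z) * w)) //;
     apply/funext => x; rewrite add0r.
apply: derivable_invC; last first.
  rewrite mulf_neq0 ?herglotz_den_neq0 // subr_eq0.
  by apply: contraTneq zw => ->; rewrite ltxx.
apply: derivable_mulC.
  have := @derivable_linC R (- z) 1 w.
  by rewrite (_ : (fun _ => _) = (fun w : C => w - z)) //;
     apply/funext => x; rewrite mul1r addrC.
have := @derivable_linC R 1 (- conjc z) w.
by rewrite (_ : (fun _ => _) = (fun w : C => 1 - conjc z * w)) //;
   apply/funext => x; rewrite mulNr.
Qed.

Lemma poisson_hol_le z w : absC z < absC w -> absC w <= 1 ->
  absC (poisson_hol z w) <= 2 / ((absC w - absC z) * (1 - absC z)).
Proof.
move=> zw w1; have z1 := lt_le_trans zw w1.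
rewrite /poisson_hol absCM absCV !absCM.
have h1 : absC w - absC z <= absC (w - z).
  by have := absCD (w - z) z; rewrite subrK; lra.
have h2 : 1 - absC z <= absC (1 - conjc z * w : C).
  apply: le_trans (absC_1B_ge _); rewrite lerD2l lerN2 absCM absC_conj.
  by rewrite -[leRHS]mulr1 ler_wpM2l ?absC_ge0.
have p1 : 0 < absC w - absC z by rewrite subr_gt0.
have p2 : 0 < 1 - absC z by rewrite subr_gt0.
apply: ler_pM; rewrite ?mulr_ge0 ?invr_ge0 ?mulr_ge0 ?absC_ge0 //.
  rewrite -[leRHS]mulr1 ler_pM ?absC_ge0 //.
  apply: (le_trans (absCD _ _)); rewrite absC1 absCN absCM absC_conj.
  have : absC z * absC z <= 1 * 1 by rewrite ler_pM ?absC_ge0 ?ltW.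
  by rewrite mulr1 => h; lra.
have q1 := lt_le_trans p1 h1; have q2 := lt_le_trans p2 h2.
by rewrite lef_pV2 ?posrE ?mulr_gt0 // ler_pM // ltW.
Qed.

(** Stronger than membership in the usual disc algebra: differentiability in the plane also at
    points of the circle allows the annulus argument to reach radius 1. *)
Definition disc_algebra (h : C -> C) :=
  (forall z, absC z <= 1 -> derivable h z 1) /\
  exists M : R, forall z, absC z <= 1 -> absC (h z) <= M.

Lemma disc_algebra_herglotz z : absC z < 1 -> disc_algebra (herglotz z).
Proof.
move=> z1; split=> [w w1|]; first exact: derivable_herglotz.
by exists (2 / (1 - absC z)) => w w1; exact: herglotz_le.
Qed.

(** The invariant of the induction on compositions. For [h = herglotz w] the left side is, up to 2
    pi, the Poisson integral at [w] of the image under [phi] of the harmonic measure of [z], while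
    the right side sees [F] only on a circle inside the disc. *)
Record boundary_transport (phi : R -> C) F : Prop := BoundaryTransport {
  bt_circle_map : circle_map phi;
  bt_derivable : forall z, absC z < 1 -> derivable F z 1;
  bt_disc : forall z, absC z < 1 -> absC (F z) < 1;
  bt_center : F 0 = 0;
  bt_transport : forall (h : C -> C) z (rho : R), disc_algebra h ->
    absC z < rho -> rho < 1 ->
    \int[mu]_(t in D) (complex.Re (h (phi t)) * poisson z (cis t)) =
    \int[mu]_(t in D)
      complex.Re (h (F (rho%:C * cis t)) * poisson_hol z (rho%:C * cis t)) }.

Lemma absC_rcis (rho t : R) : 0 <= rho -> absC (rho%:C * cis t : C) = rho.
Proof. by move=> r0; rewrite absCM absC_real absC_cis mulr1 ger0_norm. Qed.

Lemma measurable_Re_circle (G : C -> C) (rho : R) : 0 <= rho ->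
  (forall w, absC w = rho -> derivable G w 1) ->
  mble (fun t => complex.Re (G (rho%:C * cis t))).
Proof.
move=> rho0 dG; apply: continuous_mble => t.
apply: (@continuous_comp _ _ _ (fun t => rho%:C * cis t : C)
  (fun w => complex.Re (G w))).
  by apply: cvgM; [exact: cvg_cst|exact: continuous_cis].
apply: (@continuous_comp _ _ _ G (@complex.Re R)); last exact: continuous_Re.
by apply/derivableC_continuous/dG; rewrite absC_rcis.
Qed.

Lemma boundary_transport_id : boundary_transport (@cis R) id.
Proof.
split=> //; first exact: circle_map_cis.
move=> h z rho [dh _] zr r1.
have r0 : 0 < rho by rewrite (le_lt_trans (absC_ge0 z)).
transitivity (circle_mean (fun w => h w * poisson_hol z w) 1).
  apply: eq_Rintegral => t _; rewrite mul1r poisson_holE ?absC_cis //.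
  by case: (h _) => a b /=; rewrite mulr0 subr0.
apply/esym; apply: circle_mean_const => // [|w /andP[w1 w2]]; first exact: ltW.
apply: derivable_mulC; first exact: dh.
by apply: derivable_poisson_hol => //; exact: lt_le_trans w1.
Qed.

(** For z = 0 both kernels are 1, and the transported integral is a circular mean of
    [herglotz w \o F], whose value at the centre is 1. The radius 1 / 2 is arbitrary. *)
Lemma boundary_transport_poisson phi F w : boundary_transport phi F ->
  absC w < 1 -> \int[mu]_(t in D) poisson w (phi t) = 2 * pi.
Proof.
move=> [cphi dF F1 F0 tr] w1.
have h0 : absC (0 : C) < 1 / 2 by rewrite absC0 divr_gt0.
have h1 : 1 / 2 < 1 :> R by lra.
have := tr _ _ _ (disc_algebra_herglotz w1) h0 h1.
have p0 : poisson (0 : C) = fun=> 1.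
  apply/funext => z; rewrite /poisson /herglotz conjc0 mul0r addr0 subr0.
  by rewrite mul1r invr1.
rewrite p0; under eq_Rintegral do rewrite mulr1.
move=> ->.
transitivity (circle_mean (herglotz w \o F) (1 / 2)).
  apply: eq_Rintegral => t _; rewrite poisson_hol0 ?mulr1 //.
  by rewrite -absC_gt0 absC_rcis ?divr_ge0 ?divr_gt0.
rewrite circle_mean_center ?divr_gt0 //=; first by rewrite F0 herglotz0 /= mul1r.
move=> z zh; have z1 := le_lt_trans zh h1.
by apply: derivable_compC; [exact: dF|apply: derivable_herglotz => //; rewrite ltW ?F1].
Qed.

End transport.

(** * Composition with an inner function *)

Section step.
Variable R : realType.
Local Notation C := (R[i]^o).
Implicit Types (z w eta zeta : C) (F : C -> C).
Local Notation mu := (@lebesgue_measure R).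
Local Notation mble f := (measurable_fun (T := measurableTypeR R) (U := R) setT f).
Local Notation D := `[0, 2 * @pi R]%classic.

Definition radius (n : nat) : R := 1 - n.+1%:R^-1.

Lemma radius01 n : 0 <= radius n < 1.
Proof.
rewrite /radius subr_ge0 invf_le1 // ler1n /= ltrBlDr ltrDl.
by rewrite invr_gt0.
Qed.

Lemma radius_cvg : radius @ \oo --> (1 : R).
Proof.
rewrite -[X in _ --> X]subr0; apply: cvgB; first exact: cvg_cst.
apply/cvgrPdist_lt => e e0; exists (Num.bound e^-1) => // n /= hn.
rewrite sub0r normrN ger0_norm ?invr_ge0 // invf_plt ?posrE //.
apply: (lt_le_trans (archi_boundP _)); first by rewrite invr_ge0 ltW.
by rewrite ler_nat leqW.
Qed.

Lemma radius_cvg_left : radius @ \oo --> (1 : R)^'-.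
Proof.
move=> A hA; have [N _ HN] := radius_cvg hA; exists N => // n /HN /=.
by apply; case/andP: (radius01 n).
Qed.

Lemma absC_radius n z : absC z <= 1 -> absC ((radius n)%:C * z : C) < 1.
Proof.
have /andP[r0 r1] := radius01 n => z1.
rewrite absCM absC_real ger0_norm // (le_lt_trans _ r1) //.
by rewrite -[leRHS]mulr1 ler_wpM2l.
Qed.

Lemma derivable_dilation (f : C -> C) n z :
  (forall z, absC z < 1 -> derivable f z 1) -> absC z <= 1 ->
  derivable (fun z => f ((radius n)%:C * z)) z 1.
Proof.
move=> df z1.
have dl : derivable (fun z : C => (radius n)%:C * z : C) z 1.
  have := @derivable_linC R 0 (radius n)%:C z.
  by rewrite (_ : (fun _ => _) = (fun w : C => (radius n)%:C * w)) //;
     apply/funext => x; rewrite add0r.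
by apply: (derivable_compC dl); apply: df; exact: absC_radius.
Qed.

Lemma dilation_cvg (f : C -> C) z :
  derivable f z 1 -> (fun n => f ((radius n)%:C * z)) @ \oo --> f z.
Proof.
move=> /derivableC_continuous cf.
suff cr : (fun n => (radius n)%:C * z : C) @ \oo --> z.
  exact: (cvg_comp _ _ cr cf).
rewrite -[X in _ --> X]mul1r; apply: cvgM; last exact: cvg_cst.
apply/cvgC_P => e e0; have := radius_cvg => /cvgrPdist_lt /(_ e e0).
apply: filterS => n; rewrite distrC => h.
by rewrite -[1]/((1 : R)%:C) -rmorphB absC_real.
Qed.

(** The dilated map sends the closed disc into the open one, so boundary irregularities of [f] are
    not seen. *)
Lemma disc_algebra_dilation (f h : C -> C) n :
  (forall z, absC z < 1 -> derivable f z 1) ->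
  (forall z, absC z < 1 -> absC (f z) < 1) -> disc_algebra h ->
  disc_algebra (fun z => h (f ((radius n)%:C * z))).
Proof.
move=> df f1 [dh [M hM]]; split.
  move=> z z1; apply: (@derivable_compC R _ h z (derivable_dilation (n := n) df z1)).
  by apply/dh/ltW/f1/absC_radius.
by exists M => z z1; apply/hM/ltW/f1/absC_radius.
Qed.

(** The identity for [phi], applied to [h] composed with dilations of [f], passes to the limit on
    both sides: along radii at almost every [phi t] on the left, by continuity inside the disc on
    the right. *)
Lemma boundary_transport_comp phi F (f : C -> C) :
  boundary_transport phi F -> centred_inner f ->
  exists phi', boundary_transport phi' (f \o F) /\
    {ae mu, forall t, D t -> phi' t = radial_ext f (phi t)}.
Proof.
move=> bt [[df f1 fae] f0]; have [cphi dF F1 F0 tr] := bt.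
pose good zeta := radial_limit_exists f zeta /\ unit_circle (radial_ext f zeta).
pose N0 : set (measurableTypeR R) :=
  ~` [set t | t \in `[0, 2 * pi[ -> good (cis t)].
have N0D : N0 `<=` D.
  move=> t /= nt; apply: contrapT => nD; apply: nt => tI.
  by case: nD; move: tI; rewrite !in_itv /= => /andP[-> /ltW ->].
(* Each [phi t] is written [cis s] with [s] in the half-open turn, which is the range on which
   [ae_circle] speaks. *)
have [N [mN muN SN]] : mu.-negligible [set t | D t /\ ~ good (phi t)].
  have := circle_map_null_preimage cphi
    (fun w => boundary_transport_poisson bt) N0D fae.
  apply: negligibleS => t [Dt ngt]; split => //.
  have [s s2 Es] := cis_surj_2pi (cphi.1 t); exists s => //.
  by rewrite /N0 /= Es in ngt *; apply: contra_not ngt; apply; rewrite in_itv.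
pose E : set (measurableTypeR R) := D `\` N.
have mE : measurable E by exact: measurableD.
have goodE t : E t -> good (phi t).
  by move=> [Dt Nt]; apply: contrapT => ng; apply: Nt; exact: SN.
(* The value 1 off [E] keeps [phi'] on the circle for every t, as [circle_map] demands; inside the
   turn it is used only on a null set. *)
pose phi' t : C := if t \in E then radial_ext f (phi t) else 1.
pose psi n t : C := if t \in E then f ((radius n)%:C * phi t) else 1.
have psi_phi' t : (fun n => psi n t) @ \oo --> phi' t.
  rewrite /psi /phi'; case: ifPn => [|_]; last exact: cvg_cst.
  rewrite inE => /goodE [g1 _].
  exact: (@cvg_comp _ _ _ radius (fun r : R => f (r%:C * phi t)) _ _ _
    radius_cvg_left g1).
have phi'1 t : absC (phi' t) = 1.
  rewrite /phi'; case: ifPn => [|_]; last exact: absC1.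
  by rewrite inE => /goodE [].
have mind : mble (\1_E : R -> R) by exact: measurable_indic.
have mpsi n (g : C -> R) : (forall z, absC z <= 1 -> {for z, continuous g}) ->
    mble (fun t => g (f ((radius n)%:C * phi t))).
  move=> cg.
  apply: (circle_map_measurable (g := fun z => g (f ((radius n)%:C * z))) cphi).
  move=> z z1.
  apply: (@continuous_comp _ _ _ (fun z => f ((radius n)%:C * z)) g).
    exact: derivableC_continuous (derivable_dilation (n := n) df z1).
  by apply/cg/ltW/f1; exact: absC_radius.
have cphi' : circle_map phi'.
  split=> // g cg.
  (* Measurability is inherited as a pointwise limit; splitting by the indicator of [E] handles the
     default value. *)
  apply: (measurable_fun_cvg (h := fun n t => g (psi n t))).
    move=> n; rewrite (_ : (fun t => _) = (fun t =>
      g (f ((radius n)%:C * phi t)) * \1_E t + g 1 * (1 - \1_E t))).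
      apply: measurable_funD; first by apply: measurable_funM => //; exact: mpsi.
      by apply: measurable_funM => //; exact: measurable_funB.
    apply/funext => t; rewrite /psi indicE; case: (t \in E) => /=.
      by rewrite mulr1 subrr mulr0 addr0.
    by rewrite mulr0 subr0 mulr1 add0r.
  move=> t _; apply: (cvg_comp _ _ (psi_phi' t)).
  by apply: cg; rewrite phi'1.
have aeE : {ae mu, forall t, D t -> E t}.
  exists N; split => // t /= /not_implyP [Dt nEt].
  by apply: contrapT => Nt; apply: nEt.
exists phi'; split; last first.
  have [N1 [mN1 muN1 EN1]] := aeE; exists N1; split => // t nt; apply: EN1 => h.
  by apply: nt => Dt; rewrite /phi' mem_set //; exact: h.
split.
- exact: cphi'.
- by move=> z z1; exact: (@derivable_compC R F f z (dF _ z1) (df _ (F1 _ z1))).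
- by move=> z z1; apply: f1; exact: F1.
- by rewrite /= F0.
move=> h z rho hDA zrho rho1.
have [dh [M hM]] := hDA.
have z1 : absC z < 1 by exact: lt_trans rho1.
have rho0 : 0 <= rho by rewrite ltW // (le_lt_trans (absC_ge0 z)).
have M0 : 0 <= M by apply: le_trans (hM 0 _); rewrite ?absC_ge0 ?absC0.
have cReh w : absC w <= 1 -> {for w, continuous (fun w => complex.Re (h w))}.
  move=> w1; apply: (@continuous_comp _ _ _ h (@complex.Re R)).
    exact/derivableC_continuous/dh.
  exact: continuous_Re.
have Fw t : absC (F (rho%:C * cis t)) < 1 by apply: F1; rewrite absC_rcis.
have mp : mble (fun t => poisson z (cis t)).
  by apply: measurable_poisson => //; exact: circle_map_cis.
have lim1 : (fun n => \int[mu]_(t in D)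
      (complex.Re (h (f ((radius n)%:C * phi t))) * poisson z (cis t))) @ \oo -->
    \int[mu]_(t in D) (complex.Re (h (phi' t)) * poisson z (cis t)).
  apply: (@bounded_ae_cvg_Rintegral _ _ _ (M * (2 / (1 - absC z)))).
  - by move=> n; apply: measurable_funM => //; exact: (mpsi n (fun w => complex.Re (h w))).
  - apply: measurable_funM => //.
    exact: (circle_map_measurable (g := fun w => complex.Re (h w)) cphi').
  - have [N1 [mN1 muN1 EN1]] := aeE; exists N1; split => // t nt; apply: EN1 => ht.
    apply: nt => Dt; apply: cvgM; last exact: cvg_cst.
    have := psi_phi' t; rewrite /psi mem_set; last exact: ht.
    move=> cv; have p1 : absC (phi' t) <= 1 by rewrite phi'1.
    exact: (cvg_comp _ _ cv (cReh _ p1)).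
  - move=> n t _; rewrite normrM ler_pM //.
      apply: (le_trans (Re_le_absC _)); apply: hM.
      by apply/ltW/f1/absC_radius; rewrite cphi.1.
    by apply: poisson_le => //; rewrite absC_cis.
have lim2 : (fun n => \int[mu]_(t in D) complex.Re
      (h (f ((radius n)%:C * F (rho%:C * cis t))) * poisson_hol z (rho%:C * cis t)))
      @ \oo -->
    \int[mu]_(t in D) complex.Re
      (h (f (F (rho%:C * cis t))) * poisson_hol z (rho%:C * cis t)).
  have dFf w : absC w < 1 -> derivable (fun w => f (F w)) w 1.
    by move=> w1; apply: (@derivable_compC R F f w (dF _ w1)); exact/df/F1.
  have cont := fun G => @measurable_Re_circle R G rho rho0.
  have dq w : absC w = rho -> derivable (poisson_hol z) w 1.
    by move=> wr; apply: derivable_poisson_hol; rewrite wr // ltW.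
  apply: (@bounded_cvg_Rintegral _ _ _
    (M * (2 / ((rho - absC z) * (1 - absC z))))).
  - move=> n.
    apply: (cont (fun w => h (f ((radius n)%:C * F w)) * poisson_hol z w)) => w wr.
    apply: derivable_mulC; last exact: dq.
    have w1 : absC w < 1 by rewrite wr.
    apply: (@derivable_compC R F (fun w => h (f ((radius n)%:C * w))) w (dF _ w1)).
    have [+ _] := disc_algebra_dilation n df f1 hDA.
    by apply; apply/ltW/F1.
  - apply: (cont (fun w => h (f (F w)) * poisson_hol z w)) => w wr.
    apply: derivable_mulC; last exact: dq.
    have w1 : absC w < 1 by rewrite wr.
    apply: (@derivable_compC R _ h w (dFf _ w1)); apply: dh.
    by apply/ltW/f1/F1.
  - move=> t _; have ch : {for f (F (rho%:C * cis t)), continuous h}.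
      exact: derivableC_continuous (dh _ (ltW (f1 _ (Fw t)))).
    have ct := cvg_comp _ _ (dilation_cvg (df _ (Fw t))) ch.
    pose q := poisson_hol z (rho%:C * cis t).
    have cq : (fun n => h (f ((radius n)%:C * F (rho%:C * cis t))) * q : C)
        @ \oo --> (h (f (F (rho%:C * cis t))) * q : C).
      by apply: cvgM; [exact: ct|exact: cvg_cst].
    have cR : {for (h (f (F (rho%:C * cis t))) * q : C),
        continuous (@complex.Re R : C -> R)} by exact: continuous_Re.
    exact: (cvg_comp _ _ cq cR).
  - move=> n t _; apply: (le_trans (Re_le_absC _)).
    have aw := absC_rcis t rho0.
    rewrite absCM ler_pM ?absC_ge0 //.
      by apply/hM/ltW/f1/absC_radius/ltW.
    by rewrite -{2}aw; apply: poisson_hol_le; rewrite aw // ltW.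
(* The hypothesis on [phi] and [F] identifies the two sequences term by term, so their limits
   agree. *)
move: lim1; under eq_cvg do rewrite (tr _ _ _ (disc_algebra_dilation _ df f1 hDA) zrho rho1).
move=> /(cvg_lim (@Rhausdorff R)) <-; apply: cvg_lim => //.
Qed.

(** [phi] is a circle map at every t; the composed radial extensions may take default values, but
    agree with it almost everywhere. *)
Lemma boundary_transport_comp_seq (f : nat -> C -> C) :
  (forall n, centred_inner (f n)) -> forall n,
  exists phi, boundary_transport phi (comp_seq f n) /\
    {ae mu, forall t, D t -> phi t = boundary_comp f n (cis t)}.
Proof.
move=> fi; elim=> [|n [phi [bt ae]]].
  exact: boundary_transport_comp (boundary_transport_id R) (fi 0%N).
have [phi' [bt' ae']] := boundary_transport_comp bt (fi n.+1).
exists phi'; split => //.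
have [N [mN N0 hN]] := ae; have [N' [mN' N'0 hN']] := ae'.
exists (N `|` N'); split; first exact: measurableU.
  by rewrite null_set_setU.
move=> t nt; apply: contrapT => /not_orP [nN nN']; apply: nt => Dt.
have e1 : phi t = boundary_comp f n (cis t).
  by apply: contrapT => h; apply: nN; apply: hN => /(_ Dt).
have -> : phi' t = radial_ext (f n.+1) (phi t).
  by apply: contrapT => h; apply: nN'; apply: hN' => /(_ Dt).
by rewrite e1.
Qed.

End step.

(** * Recurrence *)

Section recurrence.
Variable R : realType.
Local Notation C := (R[i]^o).
Implicit Types (z w eta zeta : C) (F : C -> C).
Local Notation mu := (@lebesgue_measure R).
Local Notation mble f := (measurable_fun (T := measurableTypeR R) (U := R) setT f).
Local Notation D := `[0, 2 * @pi R]%classic.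

(** The centre is fixed, so the comparison is with 0. If p = |F n z| were at least [e], the distance
    ln ((1 + p) / (1 - p)) would be at least ln (1 + e). *)
Lemma contracting_cvg0 (F : nat -> C -> C) :
  (forall n, F n 0 = 0) -> (forall n z, absC z < 1 -> absC (F n z) < 1) ->
  contracting F -> forall z, absC z < 1 -> (fun n => F n z) @ \oo --> (0 : C).
Proof.
move=> F0 F1 cF z z1; have [->|zn0] := eqVneq z 0.
  by rewrite (_ : (fun n => _) = (fun=> 0)); [exact: cvg_cst|exact/funext].
apply/cvgC_P => e e0.
have d0 : @unit_disc R 0 by rewrite /unit_disc /= absC0.
have := cF z 0 z1 d0 zn0 => /cvgrPdist_lt.
have le0 : 0 < ln (1 + e) by rewrite ln_gt0 // ltrDl.
move=> /(_ _ le0); apply: filterS => n.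
rewrite sub0r normrN /hyp_dist F0 conjc0 mul0r !subr0 divr1.
have p1 := F1 n _ z1; have p0 := absC_ge0 (F n z).
set p := absC _ in p0 p1 * => h; rewrite ltNge; apply/negP => ep.
move: h; apply/negP; rewrite -leNgt; apply: (le_trans _ (ler_norm _)).
rewrite ler_ln ?posrE ?divr_gt0 ?subr_gt0 ?ltr_wpDr //; last lra.
by rewrite ler_pdivlMr ?subr_gt0 //; nra.
Qed.

(** Transported to a circle inside the disc, the factor [herglotz w (F n v)] tends to
    [herglotz w 0 = 1], whatever [w] is; this independence is what [weak_limit] asks for. *)
Lemma boundary_transport_cvg (phi_ : nat -> R -> C) (F : nat -> C -> C) z w :
  (forall n, boundary_transport (phi_ n) (F n)) ->
  (forall z, absC z < 1 -> (fun n => F n z) @ \oo --> (0 : C)) ->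
  absC z < 1 -> absC w < 1 ->
  (fun n => \int[mu]_(t in D) (poisson w (phi_ n t) * poisson z (cis t))) @ \oo
    --> 2 * pi.
Proof.
move=> bt Fcvg z1 w1.
pose rho := (1 + absC z) / 2.
have zr : absC z < rho by rewrite /rho; lra.
have r1 : rho < 1 by rewrite /rho; lra.
have rho0 : 0 <= rho by have := absC_ge0 z; lra.
have dq v : absC v = rho -> derivable (poisson_hol z) v 1.
  by move=> vr; apply: derivable_poisson_hol; rewrite vr // ltW.
have da1 : disc_algebra (fun=> 1 : C).
  split=> [v _|]; first exact: derivable_cst.
  by exists 1 => v _; rewrite absC1.
rewrite -[X in _ --> X](poisson_mean z1).
(* The expected limit is the transport of the constant function 1 by the identity. *)
have -> : \int[mu]_(t in D) poisson z (cis t) = \int[mu]_(t in D)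
    complex.Re (1 * poisson_hol z (rho%:C * cis t)).
  rewrite -(bt_transport (boundary_transport_id R) da1 zr r1).
  by apply: eq_Rintegral => t _; rewrite mul1r.
have -> : (fun n => \int[mu]_(t in D) (poisson w (phi_ n t) * poisson z (cis t))) =
   (fun n => \int[mu]_(t in D) complex.Re
     (herglotz w (F n (rho%:C * cis t)) * poisson_hol z (rho%:C * cis t))).
  apply/funext => n.
  by rewrite -(bt_transport (bt n) (disc_algebra_herglotz w1) zr r1).
apply: (@bounded_cvg_Rintegral _ _ _
    (2 / (1 - absC w) * (2 / ((rho - absC z) * (1 - absC z))))).
- move=> n; apply: (@measurable_Re_circle R
    (fun v => herglotz w (F n v) * poisson_hol z v) rho rho0) => v vr.
  apply: derivable_mulC; last exact: dq.
  have v1 : absC v < 1 by rewrite vr.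
  apply: (@derivable_compC R (F n) (herglotz w) v (bt_derivable (bt n) v1)).
  by apply: derivable_herglotz => //; apply/ltW/(bt_disc (bt n)).
- apply: (@measurable_Re_circle R (fun v => 1 * poisson_hol z v) rho rho0) => v vr.
  by apply: derivable_mulC; [exact: derivable_cst|exact: dq].
- move=> t _; have at1 : absC (rho%:C * cis t : C) < 1 by rewrite absC_rcis.
  have ch : {for (0 : C), continuous (herglotz w)}.
    by apply/derivableC_continuous/derivable_herglotz; rewrite ?absC0.
  have ct := cvg_comp _ _ (Fcvg _ at1) ch.
  pose q := poisson_hol z (rho%:C * cis t).
  have cq : (fun n => herglotz w (F n (rho%:C * cis t)) * q : C)
      @ \oo --> (1 * q : C).
    by apply: cvgM; [move: ct; rewrite herglotz0; exact|exact: cvg_cst].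
  have cR : {for (1 * q : C), continuous (@complex.Re R : C -> R)}.
    exact: continuous_Re.
  exact: (cvg_comp _ _ cq cR).
- move=> n t _; apply: (le_trans (Re_le_absC _)).
  have aw := absC_rcis t rho0.
  rewrite absCM ler_pM ?absC_ge0 //.
    by apply: herglotz_le => //; apply/ltW/(bt_disc (bt n)); rewrite aw.
  by rewrite -{2}aw; apply: poisson_hol_le; rewrite aw // ltW.
Qed.

(** * A Lipschitz bump around a point of the circle *)

Section tent.
Variables (eta : C) (delta : R).
Hypotheses (eta1 : absC eta = 1) (delta0 : 0 < delta).

Definition tent z : R := Num.max 0 (delta - absC (z - eta)).

Lemma tent01 z : 0 <= tent z <= delta.
Proof.
rewrite le_max lexx ge_max (ltW delta0) /= lerBlDr lerDl.
exact: absC_ge0.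
Qed.

Lemma tent_lipschitz z w : `|tent z - tent w| <= 1 * absC (z - w).
Proof.
have h : `|absC (z - eta) - absC (w - eta)| <= absC (z - w).
  rewrite (le_trans (absC_lipschitz _ _)) // mul1r.
  by rewrite opprB addrA subrK.
have := absC_ge0 (z - w); move: h; rewrite mul1r !ler_norml /tent.
move: (absC (z - w)) (absC (z - eta)) (absC (w - eta)) => x y v /andP[h1 h2] x0.
rewrite !maxEle; case: ifPn => hx; case: ifPn => hy;
  move: hx hy; rewrite -?ltNge => hx hy; apply/andP; split; lra.
Qed.

Lemma tent_neq0 z : tent z != 0 -> absC (z - eta) < delta.
Proof.
apply: contraNT; rewrite -leNgt => h; rewrite /tent max_l //.
by rewrite subr_le0.
Qed.

(** The tent has value [delta] at [eta], so some Poisson average there is at least 2 pi delta - pi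
    delta; the kernel is bounded, hence the plain integral is positive too. *)
Lemma tent_integral_gt0 : 0 < \int[mu]_(t in D) tent (cis t).
Proof.
have e0 : 0 < pi * delta by rewrite mulr_gt0 // pi_gt0.
have [r [/andP[r0 r1] Hr]] := poisson_approx ltr01 tent_lipschitz e0.
have := Hr _ eta1; rewrite /tent subrr absC0 subr0 max_r ?(ltW delta0) //.
rewrite -/tent ler_norml => /andP[h _].
have mt := circle_map_lipschitz (circle_map_cis R) tent_lipschitz.
have It : mu.-integrable D (EFin \o (fun s => tent (cis s))).
  apply: (@bounded_measurable_integrable _ _ delta mt) => t _.
  by have /andP[t0 td] := tent01 (cis t); rewrite ger0_norm.
have ar s : absC (r%:C * cis s : C) = r by rewrite absC_rcis // ltW.
have cp : forall s : R, {for s, continuous (fun s => poisson (r%:C * cis s) eta)}.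
  move=> s.
  rewrite (_ : (fun s => _) = (fun s => poisson (r%:C * eta) (cis s))).
    by apply: continuous_poisson_cis; rewrite absCM eta1 mulr1 absC_real gtr0_norm.
  by apply/funext => s'; rewrite poisson_sym // absC_cis.
have le : \int[mu]_(s in D) (poisson (r%:C * cis s) eta * tent (cis s)) <=
    \int[mu]_(s in D) (2 / (1 - r) * tent (cis s)).
  apply: le_Rintegral => //.
  - apply: continuous_mulr_integrable => // t.
    apply: (@continuous_comp _ _ _ (@cis R) tent); first exact: continuous_cis.
    exact: (lipschitz_continuousC tent_lipschitz).
  - apply: continuous_mulr_integrable => [t|t]; first exact: cvg_cst.
    apply: (@continuous_comp _ _ _ (@cis R) tent); first exact: continuous_cis.
    exact: (lipschitz_continuousC tent_lipschitz).
  move=> s _; have /andP[t0 _] := tent01 (cis s); rewrite ler_wpM2r //.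
  apply: (le_trans (ler_norm _)); rewrite -{2}(ar s).
  by apply: poisson_le; rewrite ?ar // eta1.
move: le; rewrite RintegralZl // => le.
have c0 : 0 < 2 / (1 - r) by rewrite divr_gt0 // subr_gt0.
rewrite -(pmulr_rgt0 _ c0); apply: (lt_le_trans _ le).
by have := e0; lra.
Qed.

End tent.

Lemma ae_circle_forall (P : nat -> C -> Prop) :
  (forall i, ae_circle (P i)) -> ae_circle (fun zeta => forall i, P i zeta).
Proof.
move=> H; have := negligible_bigcup H; apply: negligibleS => t /= nt.
apply: contrapT => nex; apply: nt => tI i; apply: contrapT => nP.
by apply: nex; exists i => // /(_ tI).
Qed.

Lemma ae_circle_imply (P Q : C -> Prop) :
  (forall zeta, P zeta -> Q zeta) -> ae_circle P -> ae_circle Q.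
Proof.
move=> PQ; apply: negligibleS => t /= nt h; apply: nt => tI; exact/PQ/h.
Qed.

(** The tent replaces the indicator of an arc. The conclusion also records that the visited points
    lie on the circle, since a ball around [eta] meets more than an arc. *)
Lemma boundary_recurrence (f : nat -> C -> C) eta (delta : R) :
  (forall n, centred_inner (f n)) -> contracting (comp_seq f) ->
  absC eta = 1 -> 0 < delta ->
  ae_circle (fun zeta => forall N, exists2 n, (N <= n)%N &
    absC (boundary_comp f n zeta) = 1 /\
    absC (boundary_comp f n zeta - eta) < delta).
Proof.
move=> fi cF eta1 delta0.
have /choice [phi_ Hphi] := boundary_transport_comp_seq fi.
have bt n : boundary_transport (phi_ n) (comp_seq f n) by have [] := Hphi n.
have F0 n : comp_seq f n 0 = 0 := bt_center (bt n).
have Fcvg := contracting_cvg0 F0 (fun n => @bt_disc _ _ _ (bt n)) cF.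
pose u := tent eta delta.
have u01 := tent01 eta delta0.
have uL := @tent_lipschitz eta delta.
pose m := \int[mu]_(t in D) u (cis t).
have I0 : 0 < m by exact: tent_integral_gt0.
have mu_ n : mble (fun t => u (phi_ n t)).
  exact: circle_map_lipschitz (bt_circle_map (bt n)) uL.
have mu_cis := circle_map_lipschitz (circle_map_cis R) uL.
have ID : m <= delta * (2 * pi).
  rewrite -Rintegral_circle_cst; apply: le_Rintegral => //.
  - apply: (@bounded_measurable_integrable _ _ delta mu_cis) => t _.
    by have /andP[t0 td] := u01 (cis t); rewrite ger0_norm.
  - by apply: continuous_itv_integrable => t _; exact: cvg_cst.
  - by move=> t _; case/andP: (u01 (cis t)).
(* The parameters whose orbit never meets the support of the tent from time [N] on; using [phi_]
   rather than the composed radial extensions makes this set measurable. *)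
pose A N : set (measurableTypeR R) :=
  D `&` \bigcap_n [set t | (N <= n)%N -> u (phi_ n t) = 0].
have mA N : measurable (A N).
  apply: measurableI => //; apply: bigcap_measurable => // n _.
  have [Nn|/negbTE Nn] := boolP (N <= n)%N.
    have := mu_ n measurableT [set 0] (measurable_set1 _); rewrite setTI.
    congr measurable; apply/seteqP; split => t /=; first by [].
    by apply.
  rewrite (_ : [set t | _] = setT) //.
  by apply/seteqP; split => // t _ /=.
have A0 N : mu (A N) = 0%E.
  (* One minus the mean of u / delta over the circle: it does not depend on [z], and it is below 1
     since [m] is positive. *)
  pose c := 1 - m / (delta * (2 * pi)).
  have dp : 0 < delta * (2 * pi) by rewrite mulr_gt0 // twopi_gt0.
  apply: (@poisson_density R (A N) c) => //.
  - by move=> t [].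
  - rewrite /c subr_ge0 ler_pdivrMr // mul1r ID /= ltrBlDr ltrDl.
    exact: divr_gt0 I0 dp.
  move=> z z1.
  have -> : c * (2 * pi) = 2 * pi - delta^-1 * m.
    have cE (p : R) : 0 < p -> (1 - m / (delta * p)) * p = p - delta^-1 * m.
      by move=> p0; field; rewrite !gt_eqF.
    by rewrite cE // twopi_gt0.
  pose k t := poisson z (cis t).
  have mk : mble k by apply: measurable_poisson => //; exact: circle_map_cis.
  have k0 t : 0 <= k t by apply: poisson_ge0; rewrite ?absC_cis.
  have kB t : 0 <= k t <= 2 / (1 - absC z).
    by rewrite k0 (le_trans (ler_norm _)) // poisson_le // absC_cis.
  have Ik : mu.-integrable D (EFin \o k).
    apply: (@bounded_measurable_integrable _ _ _ mk) => t _.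
    by rewrite ger0_norm //; case/andP: (kB t) => _; exact.
  have lim := weak_limit (fun n => bt_circle_map (bt n)) mk kB
    (fun w => @boundary_transport_cvg phi_ _ z w bt Fcvg z1) ltr01 uL u01.
  have tp0 : 2 * pi != 0 :> R by rewrite gt_eqF // twopi_gt0.
  have {}lim : (fun n => \int[mu]_(t in D) k t -
      delta^-1 * \int[mu]_(t in D) (u (phi_ n t) * k t)) @ \oo -->
      2 * pi - delta^-1 * m.
    rewrite poisson_mean //; apply: cvgB; first exact: cvg_cst.
    apply: cvgM; first exact: cvg_cst.
    rewrite -(mulKf tp0 m) (_ : (fun n => _) = (fun n => (2 * pi)^-1 *
      (2 * pi * \int[mu]_(t in D) (u (phi_ n t) * k t)))).
      by apply: cvgM; [exact: cvg_cst|exact: lim].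
    by apply/funext => n; rewrite mulKf.
  apply: (ler_cvg_to (cvg_cst _) lim).
  exists N => // n /= Nn.
  have Iu : mu.-integrable D (EFin \o (fun t => u (phi_ n t) * k t)).
    apply: (@bounded_measurable_integrable _ _ (delta * (2 / (1 - absC z)))).
      exact: measurable_funM.
    move=> t _; have /andP[u0 ud] := u01 (phi_ n t); have /andP[_ kb] := kB t.
    by rewrite ger0_norm ?mulr_ge0 // ler_pM.
  have Idu : mu.-integrable D (EFin \o (fun t => delta^-1 * (u (phi_ n t) * k t))).
    apply: (@bounded_measurable_integrable _ _
        (delta^-1 * (delta * (2 / (1 - absC z))))).
      by apply: measurable_funM => //; exact: measurable_funM.
    move=> t _; have /andP[u0 ud] := u01 (phi_ n t); have /andP[_ kb] := kB t.
    have d0 : 0 <= delta^-1 by rewrite invr_ge0 ltW.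
    by rewrite ger0_norm ?mulr_ge0 // ler_wpM2l // ler_pM.
  (* Pointwise, the indicator of [A N] is at most 1 - u (phi_ n t) / delta: on [A N] the tent
     vanishes because n >= N, and elsewhere u <= delta. *)
  rewrite -RintegralZl // -RintegralB //; apply: le_Rintegral => //.
  - apply: (@bounded_measurable_integrable _ _ (2 / (1 - absC z) * 1)).
      by apply: measurable_funM => //; exact: measurable_indic.
    move=> t _; have /andP[_ kb] := kB t.
    rewrite normrM; apply: ler_pM => //.
      by apply: poisson_le; rewrite ?absC_cis.
    by rewrite indicE; case: (_ \in _); rewrite ?normr1 ?normr0.
  - exact: integrable_EFinB.
  move=> t _; have /andP[u0 ud] := u01 (phi_ n t); rewrite indicE.
  have [|tA] := boolP (t \in A N).
    by rewrite inE => -[_ /(_ n Logic.I) /(_ Nn) ->]; rewrite mul0r mulr0 subr0 mulr1.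
  rewrite mulr0 mulrA -[X in X - _]mul1r -mulrBl mulr_ge0 // subr_ge0.
  by rewrite mulrC ler_pdivrMr // mul1r.
have nA : mu.-negligible (\bigcup_N A N).
  by apply: negligible_bigcup => N; exists (A N); split; [exact: mA|exact: A0|].
have nphi : mu.-negligible (\bigcup_n
    (~` [set t | D t -> phi_ n t = boundary_comp f n (cis t)])).
  by apply: negligible_bigcup => n; have [_] := Hphi n.
apply: (negligibleS _ (negligibleU nA nphi)) => t /= nt.
apply: contrapT => /not_orP [n1 n2]; apply: nt => tI N.
have Dt : D t.
  by move: tI; rewrite /= !in_itv /= => /andP[-> /ltW ->].
have ephi n : phi_ n t = boundary_comp f n (cis t).
  by apply: contrapT => h; apply: n2; exists n => // /(_ Dt).
apply: contrapT => nex; apply: n1; exists N => //; split => // n _ Nn.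
apply/eqP; apply: contrapT => /negP un; apply: nex; exists n => //.
by rewrite -ephi; split; [exact: (bt_circle_map (bt n)).1|exact: tent_neq0 un].
Qed.

End recurrence.

(** * Arcs, lower limits and density *)

Section arcs.
Variable R : realType.
Local Notation C := (R[i]^o).
Implicit Types (z w eta zeta : C).
Local Notation mu := (@lebesgue_measure R).
Local Notation D := `[0, 2 * @pi R]%classic.

Lemma sqr_absC_cis1 (s : R) : absC (cis s - 1 : C) ^+ 2 = 2 - 2 * cos s.
Proof.
rewrite sqr_absC /=; have := cos2Dsin2 s.
move: (cos s) (sin s) => x y; rewrite oppr0 addr0 => h.
transitivity (x ^+ 2 + y ^+ 2 + 1 - 2 * x); first by ring.
by rewrite h; ring.
Qed.

(** [delta] is the chord of the angle [kappa]. The squared chord 2 - 2 cos s increases with |s| up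
    to pi, and rotation by [cis c] reduces to c = 0. *)
Lemma cis_close (kappa : R) : 0 < kappa <= 1 -> exists2 delta : R, 0 < delta &
  forall (c : R) zeta, absC zeta = 1 -> absC (zeta - cis c) < delta ->
  exists2 s : R, `|s| < kappa & zeta = cis (c + s).
Proof.
move=> /andP[k0 k1]; have pi2 := pi_ge2 R.
exists (absC (cis kappa - 1 : C)).
  rewrite absC_gt0 subr_eq0; apply/eqP => -[ck _].
  have : kappa = 0 by apply: cos_eq1 => //; rewrite gtr0_norm; lra.
  by lra.
move=> c zeta z1 close.
have [s spi Es] : exists2 s : R, `|s| <= pi & zeta * conjc (cis c) = cis s :> C.
  by apply: cis_surj; rewrite absCM absC_conj absC_cis mulr1.
have Ez : zeta = cis (c + s).
  by rewrite cisD -Es mulrCA conj_unit ?absC_cis // mulr1.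
exists s => //.
have : absC (cis s - 1 : C) < absC (cis kappa - 1 : C).
  apply: le_lt_trans close; rewrite Ez cisD.
  have -> : cis c * cis s - cis c = cis c * (cis s - 1) :> C by ring.
  by rewrite absCM absC_cis mul1r.
rewrite -(@ltr_pXn2r _ 2) ?nnegrE ?absC_ge0 // !sqr_absC_cis1 => h.
have : cos kappa < cos `|s|.
  have -> : cos `|s| = cos s by case: (ger0P s) => // _; rewrite cosN.
  by lra.
rewrite ltr_cos // in_itv /= ?normr_ge0 ?spi // ltW //=.
by lra.
Qed.

Lemma arc_contains_ball (I : set C) : arc I -> (0 < arc_length I)%E ->
  exists eta (delta : R), [/\ absC eta = 1, 0 < delta &
    forall zeta, absC zeta = 1 -> absC (zeta - eta) < delta -> I zeta].
Proof.
move=> [J ->] I0.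
have [[a [b [aJ bJ ab]]]|H] := pselect (exists a b, [/\ a \in J, b \in J & a < b]).
  (* Angles within (b - a) / 2 of the midpoint stay between [a] and [b], hence in [J]; the bound 1
     is the one [cis_close] requires. *)
  pose kappa := Num.min ((b - a) / 2) 1.
  have k0 : 0 < kappa <= 1.
    by rewrite lt_min ltr01 andbT ge_min lexx orbT andbT divr_gt0 // subr_gt0.
  have [delta d0 Hd] := cis_close k0.
  exists (cis ((a + b) / 2)), delta; split => //; first exact: absC_cis.
  move=> zeta z1 /(Hd _ _ z1) [s sk ->]; exists ((a + b) / 2 + s) => //=.
  have sba : `|s| < (b - a) / 2 by rewrite (lt_le_trans sk) // ge_min lexx.
  move: sba; rewrite ltr_norml => /andP[s1 s2].
  apply: (interval_is_interval aJ bJ).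
  by apply/andP; split; lra.
have Jeq a b : a \in J -> b \in J -> a = b.
  move=> aJ bJ; apply/eqP; rewrite eq_le !leNgt; apply/andP; split; apply/negP => lt.
    by apply: H; exists b, a.
  by apply: H; exists a, b.
(* [J] now has at most one point, and [cis] is injective on the half-open turn, so the preimage also
   has at most one point. *)
have : arc_length (@cis R @` [set` J] : set C) = 0%E.
  apply: countable_lebesgue_measure0.
  have [[t0 t0S]|S0] := pselect (exists t,
      (`[0, 2 * pi[ `&` @cis R @^-1` (@cis R @` [set` J] : set C)) t).
    apply: (sub_countable _ (finite_set_countable (finite_set1 t0))).
    apply: subset_card_le => t [tI [a /= aJ at_]]; move: t0S => [t0I [b /= bJ bt]].
    apply: cis_inj; last by rewrite -at_ -bt (Jeq _ _ aJ bJ).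
    move: tI t0I => /=; rewrite !in_itv /= => /andP[? ?] /andP[? ?].
    by rewrite ltr_norml; apply/andP; split; lra.
  rewrite (_ : _ `&` _ = set0); first exact: countable0.
  by apply/seteqP; split => // t tS; apply: S0; exists t.
by move=> E; move: I0; rewrite E ltxx.
Qed.

(** Every tail infimum is already 0, so the sequence of infima is constant. *)
Lemma liminf_dist_zero_of (w : nat -> C) zeta0 :
  (forall m N : nat, exists2 n, (N <= n)%N & absC (w n - zeta0) < m.+1%:R^-1) ->
  liminf_dist_zero w zeta0.
Proof.
move=> H; rewrite /liminf_dist_zero limn_einf_lim.
rewrite (_ : einfs _ = fun=> 0%E); first exact: lim_cst.
apply/funext => N; apply/eqP; rewrite eq_le; apply/andP; split.
  apply/lee_addgt0Pr => e e0; rewrite add0e.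
  have [m me] := archi_invS e0.
  have [n Nn nm] := H m N.
  apply: (@le_trans _ _ (absC (w n - zeta0))%:E).
    by apply: ereal_inf_lbound; exists n.
  by rewrite lee_fin (le_trans (ltW nm)).
by apply: le_ereal_inf_tmp => _ [n _ <-]; rewrite lee_fin absC_ge0.
Qed.

(** Rational angles and radii 1 / (m + 1) form a countable family, over which almost-everywhere
    statements can be intersected. *)
Lemma dense_in_circle_of (w : nat -> C) :
  (forall (q : rat) (m : nat), exists n, absC (w n - cis (ratr q)) < m.+1%:R^-1) ->
  dense_in_circle w.
Proof.
move=> H zeta /cis_surj [s _ ->] B /nbhsC_P [e e0 HB].
have e20 : 0 < e / 2 by rewrite divr_gt0.
have /cvgC_P /(_ _ e20) /nbhs_ballP [d /= d0 Hd] := @continuous_cis R s.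
have sd : s < s + d by rewrite ltrDl.
have [q] := rat_in_itvoo sd; rewrite in_itv /= => /andP[sq qd].
have cq : absC (cis (ratr q) - cis s : C) < e / 2.
  by apply: Hd; rewrite /ball /= ltr_norml; apply/andP; split; lra.
have [m me] := archi_invS e20.
have [n nm] := H q m; exists (w n); split; first by exists n.
apply: HB; have -> : w n - cis s = (w n - cis (ratr q)) + (cis (ratr q) - cis s).
  by ring.
apply: (le_lt_trans (absCD _ _)); rewrite [e]splitr ltrD //.
exact: lt_le_trans nm me.
Qed.

End arcs.

Theorem corollary1p5 (R : realType) (f : nat -> R[i]^o -> R[i]^o)
    (f_inner : forall n : nat, centred_inner (f n))
    (F_contracting : contracting (comp_seq f)) :
  let Fb (zeta : R[i]^o) : nat -> R[i]^o := fun n => boundary_comp f n zeta in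
  let a := forall zeta0 : R[i]^o, unit_circle zeta0 ->
    ae_circle (fun zeta => liminf_dist_zero (Fb zeta) zeta0) in
  let b := forall I : set R[i]^o, arc I -> (0 < arc_length I)%E ->
    ae_circle (fun zeta => infinitely_often I (Fb zeta)) in
  let c := ae_circle (fun zeta => dense_in_circle (Fb zeta)) in
  ((a <-> b) /\ (b <-> c)) /\ (a /\ b /\ c).
Proof.
move=> Fb a b c.
have rec eta (delta : R) := @boundary_recurrence R f eta delta f_inner F_contracting.
have Ha : a.
  move=> zeta0 z1.
  apply: (ae_circle_imply _ (ae_circle_forall (P := fun m zeta => forall N,
    exists2 n, (N <= n)%N & absC (boundary_comp f n zeta) = 1 /\
      absC (boundary_comp f n zeta - zeta0) < m.+1%:R^-1) _)).
    move=> zeta Hz; apply: liminf_dist_zero_of => m N.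
    by have [n Nn [_ h]] := Hz m N; exists n.
  by move=> m; apply: rec => //; rewrite invr_gt0.
have Hb : b.
  move=> I arcI lenI; have [eta [delta [e1 d0 HI]]] := arc_contains_ball arcI lenI.
  apply: (ae_circle_imply _ (rec eta delta e1 d0)) => zeta Hz N.
  by have [n Nn [n1 nd]] := Hz N; exists n => //; exact: HI.
have Hc : c.
  (* Pairs of a rational angle and a radius index are coded by naturals for [ae_circle_forall]; a
     number that codes no pair imposes no condition. *)
  pose P (i : nat) (zeta : R[i]^o) :=
    if (unpickle i : option (rat * nat)) is Some (q, m) then
      exists n, absC (Fb zeta n - cis (ratr q)) < m.+1%:R^-1 else True.
  have HP i : ae_circle (P i).
    rewrite /P; case: (unpickle i) => [[q m]|]; last exact: aeW.
    apply: (ae_circle_imply _ (rec (cis (ratr q)) m.+1%:R^-1 _ _)).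
    - by move=> zeta /(_ 0%N) [n _ [_ h]]; exists n.
    - exact: absC_cis.
    - by rewrite invr_gt0.
  apply: (ae_circle_imply _ (ae_circle_forall HP)) => zeta Hz.
  apply: dense_in_circle_of => q m.
  by have := Hz (pickle (q, m)); rewrite /P pickleK.
(* All three properties have been proved outright from recurrence, so the equivalences are
   immediate. *)
by split; split.
Qed.
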